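(* Let $c\in\mathbb{R}$ be a constant and $p(n)=\frac{\log n+c+o(1)}{n}$. Then $$\lim_{n\to\infty}\mathrm{P}\bigl(G_{n,p(n)}\in\mathcal{D}^n\bigr)\ \le\ 1-e^{-2e^{-c}}e^{-2c}.$$
   Context: A digraph $G=(V,E)$ on $n$ vertices has $V=\{1,\dots,n\}$ and $E\subseteq V\times V$ (self-loops $(i,i)$ allowed). Its structured matrix $\bar A\in\{0,*\}^{n\times n}$ has $\bar A_{ij}=*$ if $(i,j)\in E$ and $\bar A_{ij}=0$ otherwise. A realization of $\bar A$ is a real matrix obtained by assigning real numbers to the $*$ entries and keeping the zero entries. $G$ (equivalently $\bar A$) is structurally diagonalizable if for almost all (with respect to Lebesgue measure on $\mathbb{R}^{|E|}$) real assignments to the $*$ entries, the resulting matrix is diagonalizable (over $\mathbb{C}$). $\mathcal{D}^n$ is the set of structurally diagonalizable digraphs with $n$ vertices. In the random digraph model $\mathcal{G}(n,p)$ on $n$ labeled vertices, each of the $n^2$ ordered pairs $(u,v)$ (including self-loops $u=v$) is an edge independently with probability $p$. $G_{n,p(n)}$ denotes a random digraph sampled from $\mathcal{G}(n,p(n))$. *)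

(* Defs.v *)
From HB Require Import structures.
From mathcomp Require Import all_boot all_order all_algebra.
From mathcomp Require Import all_classical all_reals all_analysis.
From mathcomp Require Import complex.
Import Order.TTheory GRing.Theory Num.Theory.
Import numFieldNormedType.Exports.

Set Implicit Arguments.
Unset Strict Implicit.
Unset Printing Implicit Defensive.

Local Open Scope classical_set_scope.
Local Open Scope ring_scope.

Section lebesgue_tuple.
Variable R : realType.
Local Notation RT := (measurableTypeR R).

Section lebesgue_cons.
Variables (m : nat) (mu : {sigma_finite_measure set (m.-tuple RT) -> \bar R}).

Let cons_pair (xt : RT * m.-tuple RT) : m.+1.-tuple RT :=
  [the m.+1.-tuple RT of xt.1 :: xt.2].

Let measurable_cons_pair : measurable_fun [set: RT * m.-tuple RT] cons_pair.
Proof. exact: measurable_cons. Qed.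

Definition lebesgue_cons : set (m.+1.-tuple RT) -> \bar R :=
  pushforward (lebesgue_measure \x mu)%E cons_pair.

Let lebesgue_cons0 : lebesgue_cons set0 = 0%E.
Proof. by rewrite /lebesgue_cons /pushforward preimage_set0 measure0. Qed.

Let lebesgue_cons_ge0 A : (0 <= lebesgue_cons A)%E.
Proof. exact: measure_ge0. Qed.

Let lebesgue_cons_sigma_additive : semi_sigma_additive lebesgue_cons.
Proof.
exact: (measure_semi_sigma_additive
  (s := pushforward (lebesgue_measure \x mu)%E cons_pair)).
Qed.

HB.instance Definition _ := isMeasure.Build _ _ _
  lebesgue_cons lebesgue_cons0 lebesgue_cons_ge0 lebesgue_cons_sigma_additive.

Let sigma_finite_lebesgue_cons : sigma_finite setT lebesgue_cons.
Proof.
have /sigma_finiteP[F [TF ndF Foo]] := sigma_finiteT (@lebesgue_measure R).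
have /sigma_finiteP[G [TG ndG Goo]] := sigma_finiteT mu.
exists (fun k => [set t : m.+1.-tuple RT |
    F k (thead t) /\ G k [tuple of behead t]]).
  apply/esym; rewrite -subTset => t _.
  have [i _ Fi] : (\bigcup_k F k) (thead t) by rewrite -TF.
  have [j _ Gj] : (\bigcup_k G k) [tuple of behead t] by rewrite -TG.
  exists (maxn i j) => //; split.
  - by move: Fi; exact/subsetPset/ndF/leq_maxl.
  - by move: Gj; exact/subsetPset/ndG/leq_maxr.
move=> k; have [mFk Fk] := Foo k; have [mGk Gk] := Goo k; split.
  apply: measurableI; rewrite -[X in measurable X]setTI.
  - exact: (@measurable_tnth _ RT m.+1 ord0).
  - exact: (@measurable_behead _ RT m).
rewrite /lebesgue_cons /pushforward.
rewrite [X in ((_ \x _) X)%E](_ : _ = F k `*` G k).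
  by rewrite product_measure1E// lte_mul_pinfty// ge0_fin_numE.
apply/seteqP; split => -[x t] /= [Fx Gt]; split => //.
- by rewrite (_ : t = [tuple of behead (x :: t)]) //; exact/val_inj.
- by rewrite (_ : [tuple of _] = t) //; exact/val_inj.
Qed.

HB.instance Definition _ := Measure_isSigmaFinite.Build _ _ _
  lebesgue_cons sigma_finite_lebesgue_cons.

End lebesgue_cons.

(* Lebesgue measure on R^m: the m-fold product of the Lebesgue measure on R,
   transported to m.-tuple R; R^0 is a point of mass 1. *)
Fixpoint lebesgue_tuple m :
    {sigma_finite_measure set (m.-tuple RT) -> \bar R} :=
  match m with
  | 0 => \d_([tuple of [::]] : 0.-tuple RT)
  | m'.+1 => lebesgue_cons (lebesgue_tuple m')
  end.

End lebesgue_tuple.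

(* The edge set; the vertices are 0, ..., n - 1 and loops (i, i) are allowed. *)
Definition digraph (n : nat) := {set 'I_n * 'I_n}.

(* The k-th coordinate of x is the value of the k-th edge in enum E. *)
Definition realization (R : realType) n (E : digraph n) (x : #|E|.-tuple R) :
    'M[R]_n :=
  \matrix_(i, j)
    if (i, j) \in E then nth 0 x (index (i, j) (enum E)) else 0.

Definition structurally_diagonalizable (R : realType) n : set (digraph n) :=
  [set E : digraph n | {ae lebesgue_tuple R #|E|,
     forall x : #|E|.-tuple (measurableTypeR R),
       diagonalizable (map_mx (real_complex R) (realization x))}].

(* Probability that a random digraph of G(n, p) lies in D, each of the n ^ 2
   ordered pairs being an edge independently with probability p. *)
Definition gnp_prob (R : realType) n (p : R) (D : set (digraph n)) : R :=
  \sum_(E : digraph n | E \in D)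
    \prod_(e : 'I_n * 'I_n) (if e \in E then p else 1 - p).

(* Main.v *)
Require Import Defs.
From mathcomp Require Import all_boot all_order all_algebra.
From mathcomp Require Import all_classical all_reals all_analysis.
From mathcomp Require Import fingroup perm finmap measurable_realfun complex.
From mathcomp Require Import separable spectral ring lra zify.
Import Order.TTheory GRing.Theory Num.Theory.
Import numFieldNormedType.Exports.

(** The limit is computed exactly: it is 1 - (1 - exp (- lambda)) ^ 2 with
    lambda = exp (- c), the limiting probability that a random digraph has no
    zero row or no zero column. The stated bound follows from
    lambda * exp (- lambda) <= 1 - exp (- lambda).

    Let I be the set of zero rows and J the set of zero columns of a digraph E.
    Two facts decide whether E is structurally diagonalizable, outside a set of
    exceptional digraphs. Both come from writing a realization as A = T *m B,
    where T or B merely selects m rows or columns, and looking at the m by m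
    matrix B *m T.
    - If J is empty and the vertices outside I can be covered by disjoint
      cycles, take B to be the rows outside I. Weighting the cycles suitably
      gives B *m T simple nonzero eigenvalues, hence almost every realization
      has this property; then 'X times the characteristic polynomial of B *m T
      annihilates A and has simple roots, so A is diagonalizable
      ([diagonalizable_factor], [cycle_cover_rows]). The case of an empty I is
      dual.
    - If I and J are nonempty and disjoint, |J| <= |I|, and the rows outside I
      can be matched into columns, then almost every A has rank m = n - |I|,
      while B *m T has a zero column; this gives v with v A ^ 2 = 0 and
      v A <> 0, so A is not diagonalizable ([not_diagonalizable_factor],
      [not_diagonalizable_rows]). The case |I| <= |J| is dual.
    A condition that amounts to the non-vanishing of a polynomial in the
    entries holds almost everywhere once it holds at one point
    ([ae_mpeval_neq0]).

    The matchings come from Hall's theorem. Adding a loop at every zero row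
    turns a cycle cover of the complement of I into a perfect matching, and a
    violation of Hall's condition yields a set of at most n / 3 rows (or, dually,
    columns) with too few neighbours, or a large zero block. These two defects,
    and a vertex that is both a zero row and a zero column, are excluded with
    probability tending to 1 by union bounds. For the first one
    ([Pr_deficient_le]) the union runs over inclusion-minimal violating sets S:
    their |S| - 1 neighbours are all hit at least twice, loops included, and
    these 2 (|S| - 1) edges make the bound summable, although the expected
    number of zero rows does not tend to 0.

    Finally the probability that I or J is empty is computed by
    inclusion-exclusion. The events of having no zero row and no zero column
    are almost independent, with an explicit error term
    ([Pr_no_zero_row_col_dist]), and each has probability (1 - q ^ n) ^ n with
    q = 1 - p and n q ^ n --> lambda. *)

Set Implicit Arguments.
Unset Strict Implicit.
Unset Printing Implicit Defensive.

Local Open Scope classical_set_scope.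
Local Open Scope ring_scope.

(** * Non-vanishing of a polynomial almost everywhere *)

Section IteratedPolynomials.
Variable R : comNzRingType.

(** Polynomials in m variables, as iterated univariate polynomials: the last
    variable adjoined is the first coordinate of the tuple, which is what the
    recursive product measure integrates out first. *)
Fixpoint mpolyring (m : nat) : comNzRingType :=
  if m is m'.+1 then ({poly (mpolyring m')} : comNzRingType) else R.

Fixpoint mpeval (m : nat) : m.-tuple R -> {rmorphism mpolyring m -> R} :=
  match m with
  | 0 => fun=> idfun
  | m'.+1 => fun t => horner_eval (thead t) \o map_poly (mpeval (behead_tuple t))
  end.

Fixpoint mpvar (m : nat) (i : nat) : mpolyring m :=
  match m with
  | 0 => 0
  | m'.+1 => if i is i'.+1 then (mpvar m' i')%:P else 'X
  end.

Lemma mpeval_var m (t : m.-tuple R) i : mpeval t (mpvar m i) = nth 0 t i.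
Proof.
elim: m t i => [|m IHm] t i /=; first by rewrite tuple0 nth_nil.
rewrite /horner_eval; case/tupleP: t => x t; case: i => [|i] /=.
  by rewrite map_polyX hornerX.
rewrite map_polyC hornerC /= IHm /=; congr (nth 0 _ _).
Qed.

Lemma mpevalS m (t : m.+1.-tuple R) (P : mpolyring m.+1) :
  mpeval t P = \sum_(i < size (P : {poly mpolyring m}))
    mpeval (behead_tuple t) (P : {poly mpolyring m})`_i * thead t ^+ i.
Proof.
rewrite /= /horner_eval (horner_coef_wide _ (size_poly _ _)).
by apply: eq_bigr => i _; rewrite coef_map.
Qed.

Lemma mpeval_cons m x (t : m.-tuple R) (P : mpolyring m.+1) :
  mpeval [tuple of x :: t] P = (map_poly (mpeval t) P).[x].
Proof.
rewrite /= /horner_eval theadE.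
suff -> : behead_tuple [tuple of x :: t] = t :> m.+1.-1.-tuple R by [].
exact/val_inj.
Qed.

End IteratedPolynomials.

Section GenericNonvanishing.
Variable R : realType.
Local Notation RT := (measurableTypeR R).

Lemma measurable_mpeval m (P : mpolyring R m) :
  measurable_fun [set: m.-tuple RT] (fun x => mpeval x P : RT).
Proof.
elim: m P => [|m IHm] P; first exact: measurable_cst.
rewrite [X in measurable_fun _ X](_ : _ = fun x : m.+1.-tuple RT =>
  \sum_(i < size (P : {poly mpolyring R m}))
    mpeval (behead_tuple x : m.-tuple R) (P : {poly mpolyring R m})`_i
      * thead x ^+ i); last by apply/funext => x; rewrite -mpevalS.
apply: measurable_sum => i; apply: measurable_funM.
  apply: (measurableT_comp (IHm _)); exact: measurable_behead.
apply: measurable_funX; exact: (@measurable_tnth _ RT m.+1 ord0).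
Qed.

Lemma finite_roots (p : {poly R}) : p != 0 -> finite_set [set x | p.[x] = 0].
Proof.
move=> p0; apply: contrapT => /(infinite_set_fset (size p))[B Bp sB].
suff : (size (enum_fset B) < size p)%N by rewrite ltnNge sB.
apply: max_poly_roots; rewrite ?fset_uniq //.
by apply/allP => x xB; apply/eqP; exact: Bp.
Qed.

(** By Fubini: a coefficient that does not vanish at the tail of x0 does not
    vanish for almost every tail, and for such a tail only the finitely many
    roots of a nonzero univariate polynomial are excluded. *)
Lemma ae_mpeval_neq0 m (P : mpolyring R m) (x0 : m.-tuple R) :
  mpeval x0 P != 0 ->
  {ae lebesgue_tuple R m, forall x : m.-tuple RT, mpeval x P != 0}.
Proof.
suff nullP : mpeval x0 P != 0 ->
    lebesgue_tuple R m [set x : m.-tuple RT | mpeval x P = 0] = 0%E.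
  move=> /nullP P0; exists [set x : m.-tuple RT | mpeval x P = 0]; split => //.
    rewrite -[X in measurable X]setTI.
    exact: (measurable_mpeval P measurableT (measurable_set1 0)).
  by move=> x /= /negP/negPn/eqP.
elim: m P x0 => [|m IHm] P x0 P0.
  suff -> : [set x : 0.-tuple RT | mpeval x P = 0] = set0 by rewrite measure0.
  by apply/seteqP; split => // x /= xP; move: P0; rewrite [mpeval _ _]xP eqxx.
pose Z := [set xt : RT * m.-tuple RT | mpeval [tuple of xt.1 :: xt.2] P = 0].
have mZ : measurable Z.
  have mc : measurable_fun setT
      (fun xt : RT * m.-tuple RT => [tuple of xt.1 :: xt.2]).
    exact: measurable_cons.
  have := measurableT_comp (measurable_mpeval P) mc.
  by move=> /(_ measurableT _ (measurable_set1 0)); rewrite setTI.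
rewrite [LHS](_ : _ = (lebesgue_measure \x lebesgue_tuple R m)%E Z) //.
rewrite (@product_measure_unique _ _ RT (m.-tuple RT) R lebesgue_measure
   (lebesgue_tuple R m) (lebesgue_measure \x^ lebesgue_tuple R m)%E) //; last first.
  by move=> A B mA mB; exact: product_measure2E.
rewrite /product_measure2.
have [i iP] : exists i, mpeval (behead_tuple x0) (P : {poly mpolyring R m})`_i != 0.
  apply: contrapT => /forallNP Pi; move/eqP: P0; apply; rewrite mpevalS.
  by rewrite big1 // => i _; have /negP/negPn/eqP-> := Pi i; rewrite mul0r.
(* the null set of tails at which the coefficient of index i vanishes *)
pose N := [set t : m.-tuple RT | mpeval t (P : {poly mpolyring R m})`_i = 0].
have mN : measurable N.
  rewrite -[X in measurable X]setTI.
  exact: (measurable_mpeval _ measurableT (measurable_set1 0)).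
rewrite -[RHS](@integral0 _ _ _ (lebesgue_tuple R m) setT).
apply: ge0_ae_eq_integral => //=.
  exact: measurable_fun_ysection.
exists N; split => //; first exact: IHm iP.
move=> t /= tZ; apply: contrapT => Nt; apply: tZ => _.
apply: countable_lebesgue_measure0; apply: finite_set_countable.
apply: sub_finite_set (finite_roots (_ : map_poly (mpeval t) (P : {poly mpolyring R m}) != 0)).
  by move=> x /ysectionP; rewrite /Z /mkset mpeval_cons.
apply/eqP => /(congr1 (fun p : {poly R} => p`_i)); rewrite coef_map coef0.
exact: Nt.
Qed.

End GenericNonvanishing.

(** * Diagonalizability of a product through its reversed product *)

Section FactoredMatrices.

(** This transfers polynomial identities of the small matrix B *m T to T *m B. *)
Lemma horner_mx_factor (F : comNzRingType) n m (T : 'M[F]_(n.+1, m.+1))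
    (B : 'M[F]_(m.+1, n.+1)) (q : {poly F}) :
  T *m B *m horner_mx (T *m B) q = T *m horner_mx (B *m T) q *m B.
Proof.
elim/poly_ind: q => [|q a IHq]; first by rewrite !rmorph0 !mulmx0 mul0mx.
rewrite !rmorphD !rmorphM /= !horner_mx_X !horner_mx_C !mulmxDr mulmxDl.
rewrite -!mulmxE [_ *m (horner_mx _ q *m _)]mulmxA IHq !mulmxA; congr (_ + _).
by rewrite !mul_mx_scalar -scalemxAl.
Qed.

Lemma mulmx_horner_eigen (F : fieldType) n (A : 'M[F]_n.+1) (v : 'rV[F]_n.+1) z
    (q : {poly F}) :
  v *m A = z *: v -> v *m horner_mx A q = q.[z] *: v.
Proof.
move=> vA; elim/poly_ind: q => [|q a IHq].
  by rewrite rmorph0 mulmx0 horner0 scale0r.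
rewrite rmorphD rmorphM /= horner_mx_X horner_mx_C mulmxDr -mulmxE mulmxA IHq.
by rewrite -scalemxAl vA mul_mx_scalar scalerA hornerMXaddC -scalerDl.
Qed.

Lemma coprimep_char_poly (F : closedFieldType) n (A : 'M[F]_n.+1) (q : {poly F}) :
  \det (horner_mx A q) != 0 -> coprimep (char_poly A) q.
Proof.
move=> detq; apply/Pdiv.ClosedField.coprimepP => z.
rewrite -eigenvalue_root_char => /eigenvalueP[v vA v0].
apply: contraNneq detq => qz; apply/det0P; exists v => //.
by rewrite (mulmx_horner_eigen q vA) qz scale0r.
Qed.

Lemma det_horner_mx_neq0 (F : fieldType) n (A : 'M[F]_n.+1) (q : {poly F}) :
  coprimep (char_poly A) q -> \det (horner_mx A q) != 0.
Proof.
move=> /Bezout_coprimepP[[u w] /= uw]; apply/negP => /det0P[v v0 vq].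
have [a a0 aE] : exists2 a, a != 0 & u * char_poly A + w * q = a%:P.
  by move: uw; rewrite -size_poly_eq1 => /size_poly1P.
have := congr1 (fun q => v *m horner_mx A q) aE.
rewrite rmorphD !rmorphM /= Cayley_Hamilton mulr0 add0r horner_mx_C.
rewrite (comm_horner_mx2 A w q) -mulmxE mulmxA vq mul0mx mul_mx_scalar.
by move/esym/eqP; rewrite scaler_eq0 (negPf a0) (negPf v0).
Qed.

(** Over a closed field, its non-vanishing says that C has simple nonzero
    eigenvalues, that is, that 'X * char_poly C is separable. A determinant is
    used rather than a gcd or a resultant because it commutes with every ring
    morphism. *)
Definition simple_spectrum (F : comNzRingType) m (C : 'M[F]_m.+1) : F :=
  \det (horner_mx C ('X * (char_poly C)^`())).

(** The polynomial 'X * char_poly (B *m T) annihilates T *m B, by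
    Cayley-Hamilton for B *m T, and its roots are simple. *)
Lemma diagonalizable_factor (F : closedFieldType) n m (T : 'M[F]_(n.+1, m.+1))
    (B : 'M[F]_(m.+1, n.+1)) :
  simple_spectrum (B *m T) != 0 -> diagonalizable (T *m B).
Proof.
move=> /coprimep_char_poly; rewrite coprimepMr => /andP[copX copd].
set p := 'X * char_poly (B *m T).
have [rs rsP] := closed_field_poly_normal p.
have lcp : lead_coef p = 1.
  by rewrite lead_coefM lead_coefX mul1r; apply/eqP; exact: char_poly_monic.
rewrite lcp scale1r in rsP.
apply/diagonalizableP; exists rs.
  rewrite -separable_prod_XsubC -rsP separable_mul unlock derivX.
  by rewrite coprimep1 copd coprimep_sym.
rewrite -rsP; apply: mxminpoly_min.
rewrite rmorphM /= horner_mx_X -mulmxE horner_mx_factor.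
by rewrite Cayley_Hamilton mulmx0 mul0mx.
Qed.

Lemma diagonalizable_sqr0 (F : fieldType) n (A : 'M[F]_n) (v : 'rV[F]_n) :
  diagonalizable A -> v *m A *m A = 0 -> v *m A = 0.
Proof.
case=> P Pu /diagonalizable_forPex[d /(simmxLR Pu) ->] vAA.
rewrite (mxpoly.conjVmx _ Pu) !mulmxA in vAA *.
rewrite -[_ *m P *m _](mulmxA _ P) (mulmxV Pu) mulmx1 in vAA.
move/(congr1 (mulmxr (invmx P))): vAA; rewrite /= mul0mx mulmxK //.
set w := v *m _ => wdd; suff -> : w *m diag_mx d = 0 by rewrite mul0mx.
apply/rowP => j; have := congr1 (fun u : 'rV_n => u 0 j) wdd.
rewrite !mul_mx_diag !mxE => /eqP; rewrite mulf_eq0 => /orP[/eqP//|/eqP->].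
by rewrite mulr0.
Qed.

(** A vector u in the kernel of B *m T lifts to v with v *m T = u; the square
    of T *m B kills v, but T *m B does not. *)
Lemma not_diagonalizable_factor (F : fieldType) n m (T : 'M[F]_(n, m))
    (B : 'M[F]_(m, n)) :
  row_full T -> row_free B -> \det (B *m T) = 0 -> ~ diagonalizable (T *m B).
Proof.
move=> Tfull Bfree /eqP/det0P[u u0 uC] /diagonalizable_sqr0 dA.
have [w wT] : exists w, w *m T = u.
  by exists (u *m pinvmx T); rewrite mulmxKpV // submx_full.
have := dA w; rewrite !mulmxA wT -[u *m B *m T]mulmxA uC mul0mx.
by move=> /(_ erefl)/eqP; rewrite mulmx_free_eq0 // (negPf u0).
Qed.

End FactoredMatrices.

Lemma map_simple_spectrum (F K : comNzRingType) (f : {rmorphism F -> K}) m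
    (C : 'M[F]_m.+1) :
  f (simple_spectrum C) = simple_spectrum (map_mx f C).
Proof.
rewrite /simple_spectrum -det_map_mx map_horner_mx rmorphM /= map_polyX.
by rewrite -deriv_map map_char_poly.
Qed.

(** The permutation matrix of s in which every edge of a cycle carries the same
    weight, one more than the representative of the cycle, so that distinct
    cycles have distinct nonzero weights. *)
Definition cycle_weight_mx (F : nzRingType) m (s : {perm 'I_m.+1}) : 'M[F]_m.+1 :=
  \matrix_(i, j) ((froot s i).+1%:R *+ (s i == j)).

Section WeightedPermutation.
Variables (C : numClosedFieldType) (m : nat) (s : {perm 'I_m.+1}).
Local Notation cycle_weight_mx := (cycle_weight_mx C s).

Let wt (i : 'I_m.+1) : C := (froot s i).+1%:R.

Let wt_gt0 i : 0 < wt i. Proof. by rewrite ltr0n. Qed.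

Let wt_perm i : wt (s i) = wt i.
Proof.
rewrite /wt; congr _.+1%:R; congr nat_of_ord; apply/esym/fingraph.rootP.
  exact: fconnect_sym (@perm_inj _ s).
exact: fconnect1.
Qed.

Let wt_inj i j : wt i = wt j -> fconnect s i j.
Proof.
move/eqP; rewrite eqr_nat eqSS => /eqP/val_inj/fingraph.rootP; apply.
exact: fconnect_sym (@perm_inj _ s).
Qed.

Let eigen_step (v : 'rV[C]_m.+1) z i :
  v *m cycle_weight_mx = z *: v -> v 0 i * wt i = z * v 0 (s i).
Proof.
move=> /rowP/(_ (s i)); rewrite !mxE (bigD1 i) //= mxE eqxx mulr1n => <-.
rewrite big1 ?addr0 // => j ji; rewrite mxE.
by rewrite (inj_eq perm_inj) (negPf ji) mulr0n mulr0.
Qed.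

Let eigen_iter (v : 'rV[C]_m.+1) z i k :
  v *m cycle_weight_mx = z *: v -> v 0 i * wt i ^+ k = z ^+ k * v 0 (iter k s i).
Proof.
move=> vz; elim: k => [|k IHk] /=; first by rewrite !expr0 mulr1 mul1r.
rewrite !exprSr mulrA IHk -!mulrA -(eigen_step _ vz); congr (_ * (_ * _)).
by elim: k {IHk} => //= k ->; rewrite wt_perm.
Qed.

Let eigen_wt (v : 'rV[C]_m.+1) z i :
  v *m cycle_weight_mx = z *: v -> v 0 i != 0 ->
  wt i ^+ #[s]%g = z ^+ #[s]%g.
Proof.
move=> vz vi; apply: (mulfI vi); rewrite (eigen_iter _ _ vz) mulrC.
by rewrite -permX expg_order perm1.
Qed.

(** An eigenvector is determined along a cycle by one of its entries, and it
    lives on a single cycle: the modulus of the eigenvalue is the weight. *)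
Let eigen_uniq (v w : 'rV[C]_m.+1) z :
  v *m cycle_weight_mx = z *: v -> w *m cycle_weight_mx = z *: w -> v != 0 ->
  w != 0 -> exists a b, [/\ a != 0 & a *: v = b *: w].
Proof.
move=> vz wz /rV0Pn[i vi] w0.
have z0 : z != 0.
  apply/eqP => z0; have := eigen_wt vz vi; rewrite z0 expr0n -leqn0 leqNgt.
  rewrite order_gt0 => /eqP; rewrite expf_eq0 order_gt0 /=.
  by rewrite gt_eqF.
have key (u : 'rV[C]_m.+1) : u *m cycle_weight_mx = z *: u -> u 0 i = 0 -> u = 0.
  move=> uz ui; apply/eqP; apply: contraTT isT => /rV0Pn[j uj].
  have /eqP := etrans (eigen_wt vz vi) (esym (eigen_wt uz uj)).
  rewrite eqrXn2 ?order_gt0 ?ltW // => /eqP/wt_inj ij.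
  have := eigen_iter i (findex s i j) uz; rewrite ui mul0r iter_findex //.
  by move/esym/eqP; rewrite mulf_eq0 expf_eq0 (negPf z0) andbF (negPf uj).
have wi : w 0 i != 0 by apply: contra_neq w0; exact: key.
exists (w 0 i), (v 0 i); split=> //; apply/eqP; rewrite -subr_eq0; apply/eqP.
apply: key; last by rewrite !mxE mulrC subrr.
by rewrite mulmxBl -!scalemxAl vz wz scalerBr !scalerA ![z * _]mulrC.
Qed.

(** The weights are constant on cycles, so the diagonal matrix of weights
    commutes with the permutation matrix. *)
Let normal : cycle_weight_mx \is normalmx.
Proof.
have conj_wt i : (wt i)^* = wt i by rewrite geC0_conj // ltW.
apply/normalmxP/matrixP => i j; rewrite !mxE.
transitivity (wt i ^+ 2 *+ (i == j)).
  rewrite (bigD1 (s i)) //= big1 ?addr0 => [|k ki]; last first.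
    by rewrite !mxE eq_sym (negPf ki) mulr0n mul0r.
  rewrite !mxE -!/(wt _) eqxx mulr1n [s j == _]eq_sym (inj_eq perm_inj).
  by case: eqVneq => [->|_]; rewrite ?mulr1n ?mulr0n ?conj_wt ?rmorph0 ?mulr0 ?expr2.
rewrite (bigD1 (s^-1 i)%g) //= big1 ?addr0 => [|k ki]; last first.
  have /negPf sk : s k != i by apply: contraNneq ki => <-; rewrite permK.
  by rewrite !mxE sk mulr0n rmorph0 mul0r.
rewrite !mxE -!/(wt _) permKV eqxx mulr1n conj_wt -[wt (s^-1 i)%g]wt_perm permKV.
by case: eqVneq => [->|_]; rewrite ?mulr1n ?mulr0n ?mulr0 ?expr2.
Qed.

(** The matrix is normal, hence diagonalizable, and its eigenspaces are lines,
    so it has as many eigenvalues as its dimension. *)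
Lemma simple_spectrum_cycle_weight : simple_spectrum cycle_weight_mx != 0.
Proof.
set A := cycle_weight_mx.
have /orthomx_spectralP := normal; set P := spectralmx _; set d := spectral_diag _.
move=> AE; have Pu : P \in unitmx by exact: spectral_unit.
have PA i : row i P *m A = d 0 i *: row i P.
  by rewrite -row_mul [A]AE !mulmxA mulmxV // mul1mx row_mul row_diag_mx -scalemxAl -rowE.
have Pfree : row_free P by rewrite row_free_unit.
have row0 i : row i P != 0.
  apply/eqP => Pi; have := Pu.
  by rewrite -row_free_unit; move/row_freeP => [Q /(congr1 (row i))];
    rewrite row_mul Pi mul0mx row1 => /rowP/(_ i)/eqP; rewrite !mxE !eqxx eq_sym oner_eq0.
(* equal eigenvalues would make two rows of the invertible P proportional *)
have d_inj : injective (fun i => d 0 i).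
  move=> i j dij; apply/eqP; apply: contraT => ij.
  have := PA j; rewrite -dij => PAj.
  have [a [b [a0 ab]]] := eigen_uniq (PA i) PAj (row0 i) (row0 j).
  have : (a *: delta_mx 0 i - b *: delta_mx 0 j) *m P = 0 :> 'rV[C]_m.+1.
    by rewrite mulmxBl -!scalemxAl -!rowE ab subrr.
  move/eqP; rewrite mulmx_free_eq0 // => /eqP/rowP/(_ i)/eqP.
  by rewrite !mxE !eqxx (negPf ij) mulr1 mulr0 subr0 (negPf a0).
have charE : char_poly A = \prod_(z <- [seq d 0 i | i : 'I_m.+1]) ('X - z%:P).
  have /monicP lc := char_poly_monic A.
  rewrite [LHS](@all_roots_prod_XsubC _ _ [seq d 0 i | i : 'I_m.+1]) ?lc ?scale1r //.
  - by rewrite size_char_poly size_map size_enum_ord.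
  - apply/allP => _ /mapP[i _ ->]; rewrite -eigenvalue_root_char.
    by apply/eigenvalueP; exists (row i P).
  - by rewrite uniq_rootsE map_inj_uniq // enum_uniq.
apply: det_horner_mx_neq0; rewrite coprimepMr; apply/andP; split; last first.
  have : separable_poly (char_poly A).
    by rewrite charE separable_prod_XsubC map_inj_uniq // enum_uniq.
  by rewrite unlock.
rewrite coprimepX -eigenvalue_root_char; apply/negP => /eigenvalueP[v].
move=> v0 /rV0Pn[i vi].
have := eigen_step (s^-1%g i) v0.
have := eigen_step i v0; rewrite mul0r => /eqP; rewrite mulf_eq0 (negPf vi).
by rewrite gt_eqF.
Qed.

End WeightedPermutation.

(** * Generic diagonalizability of a zero pattern *)

Section GenericRealization.
Variables (R : realType) (n : nat) (E : digraph n).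
Local Notation RT := (measurableTypeR R).

Definition generic_mx : 'M[mpolyring R #|E|]_n :=
  \matrix_(i, j) if (i, j) \in E then mpvar R #|E| (index (i, j) (enum E)) else 0.

Lemma map_generic_mx (x : #|E|.-tuple R) :
  map_mx (mpeval x) generic_mx = realization x.
Proof.
apply/matrixP => i j; rewrite !mxE; case: ifP => _; last by rewrite rmorph0.
exact: mpeval_var.
Qed.

Lemma realization_surj (w : 'I_n * 'I_n -> R) : exists x : #|E|.-tuple R,
  forall i j, realization x i j = if (i, j) \in E then w (i, j) else 0.
Proof.
have sz : size (map w (enum E)) == #|E| by rewrite size_map -cardE.
exists (Tuple sz) => i j; rewrite mxE; case: ifP => // ijE.
by rewrite (nth_map (i, j)) ?nth_index // ?index_mem mem_enum.
Qed.

(** The property has to be the non-vanishing of a polynomial in the entries; one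
    realization that satisfies it is then enough. *)
Lemma ae_realization (Q : mpolyring R #|E|) (P : 'M[R]_n -> R) :
  (forall x, mpeval x Q = P (realization x)) ->
  (exists x : #|E|.-tuple R, P (realization x) != 0) ->
  {ae lebesgue_tuple R #|E|,
     forall x : #|E|.-tuple RT, P (realization x) != 0}.
Proof.
move=> QP [x0]; rewrite -QP => /ae_mpeval_neq0.
by apply: filterS => x; rewrite QP.
Qed.

Lemma lebesgue_tuple_gt0 m : (0 < lebesgue_tuple R m [set: m.-tuple RT])%E.
Proof.
elim: m => [|m IHm]; first by rewrite /= diracT lte01.
rewrite [X in (_ < X)%E](_ : _ = (lebesgue_measure \x lebesgue_tuple R m)%E
  ([set: RT] `*` [set: m.-tuple RT])); last by rewrite setXTT.
rewrite product_measure1E // mule_gt0 //.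
have mu := @lebesgue_measure_itv R `]-oo, +oo[%R; rewrite set_itvNyy /= in mu.
exact: (eq_ind_r (fun z => (0 < z)%E) (ltry 0) mu).
Qed.

Lemma ae_contradiction (P : #|E|.-tuple R -> Prop) :
  {ae lebesgue_tuple R #|E|, forall x : #|E|.-tuple RT, P x} ->
  {ae lebesgue_tuple R #|E|, forall x : #|E|.-tuple RT, ~ P x} -> False.
Proof.
have PF := ae_properfilter_algebraOfSetsType (lebesgue_tuple_gt0 #|E|).
move=> aeP aeN; apply: (@filter_not_empty _ _ PF).
by apply: filterS2 aeP aeN => x Px; exact.
Qed.

End GenericRealization.

Section Selection.
Variables (F : fieldType) (n m : nat) (h : 'I_m -> 'I_n).
Hypothesis h_inj : injective h.

Definition select_mx : 'M[F]_(m, n) := \matrix_(k, j) (h k == j)%:R.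

Lemma mul_select_mx p (A : 'M[F]_(n, p)) : select_mx *m A = rowsub h A.
Proof.
apply/matrixP => k j; rewrite !mxE (bigD1 (h k)) //= mxE eqxx mul1r big1 ?addr0 //.
by move=> i ih; rewrite mxE eq_sym (negPf ih) mul0r.
Qed.

Lemma mul_mx_trselect p (A : 'M[F]_(p, n)) : A *m select_mx^T = colsub h A.
Proof.
apply: trmx_inj; rewrite trmx_mul trmxK mul_select_mx.
by apply/matrixP => i j; rewrite !mxE.
Qed.

Lemma select_mxK : select_mx *m select_mx^T = 1%:M.
Proof.
rewrite mul_select_mx; apply/matrixP => i j; rewrite !mxE.
by rewrite (inj_eq h_inj) eq_sym.
Qed.

Lemma row_free_select : row_free select_mx.
Proof. by apply/row_freeP; exists select_mx^T; exact: select_mxK. Qed.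

Lemma row_full_trselect : row_full select_mx^T.
Proof. by apply/row_fullP; exists select_mx; exact: select_mxK. Qed.

Lemma trselect_rowsub (A : 'M[F]_n) :
  (forall i j, A i j != 0 -> i \in codom h) -> A = select_mx^T *m rowsub h A.
Proof.
move=> Ah; apply/matrixP => i j; rewrite mxE.
have [/codomP[k ->]|ih] := boolP (i \in codom h).
  rewrite (bigD1 k) //= !mxE eqxx mul1r big1 ?addr0 // => l lk.
  by rewrite !mxE (inj_eq h_inj) (negPf lk) mul0r.
rewrite big1 => [|l _]; first by apply/eqP; apply: contraNT ih; exact: Ah.
rewrite !mxE; case: eqP => [hl|_]; last by rewrite mul0r.
by rewrite -hl codom_f in ih.
Qed.

Lemma colsub_select (A : 'M[F]_n) :
  (forall i j, A i j != 0 -> j \in codom h) -> A = colsub h A *m select_mx.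
Proof.
move=> Ah; apply: trmx_inj; rewrite trmx_mul {1}[A^T]trselect_rowsub.
  by congr (_ *m _); apply/matrixP => i j; rewrite !mxE.
by move=> i j; rewrite mxE; exact: Ah.
Qed.

End Selection.

Section DiagonalizabilityCriteria.
Variables (R : realType) (n : nat) (E : digraph n.+1).
Local Notation RC := (real_complex R).
Local Notation complex_realization x := (map_mx RC (@realization R n.+1 E x)).

(** The witness puts the cycle weights on the edges of the cycle cover and zero
    on all others. *)
Lemma ae_simple_spectrum m (h : 'I_m.+1 -> 'I_n.+1) (s : {perm 'I_m.+1}) :
  injective h -> (forall k, (h k, h (s k)) \in E) ->
  {ae lebesgue_tuple R #|E|, forall x : #|E|.-tuple (measurableTypeR R),
     simple_spectrum (mxsub h h (realization x)) != 0}.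
Proof.
move=> h_inj hs.
apply: (@ae_realization _ _ _ (simple_spectrum (mxsub h h (generic_mx R E)))
  (fun A => simple_spectrum (mxsub h h A))).
  by move=> x; rewrite map_simple_spectrum map_mxsub map_generic_mx.
pose w e : R := \sum_k (froot s k).+1%:R *+ ((h k, h (s k)) == e).
have [x xw] := realization_surj E w; exists x.
suff -> : mxsub h h (realization x) = cycle_weight_mx R s.
  apply/eqP => /(congr1 RC); rewrite map_simple_spectrum rmorph0.
  rewrite (_ : map_mx _ _ = cycle_weight_mx _ s); last first.
    by apply/matrixP => i j; rewrite !mxE rmorphMn rmorph_nat.
  by apply/eqP; exact: simple_spectrum_cycle_weight.
apply/matrixP => k l; have := xw (h k) (h l); rewrite !mxE => ->.
rewrite /w (bigD1 k) //= big1 ?addr0 => [|i ik]; last first.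
  by rewrite xpair_eqE (inj_eq h_inj) (negPf ik).
rewrite xpair_eqE eqxx (inj_eq h_inj) /=.
by case: eqVneq => [<-|_]; rewrite ?hs // mulr0n if_same.
Qed.

(** The witness puts 1 on the matched edges and 0 on all others. *)
Lemma ae_matching_minor m (h g : 'I_m -> 'I_n.+1) :
  injective h -> injective g -> (forall k, (h k, g k) \in E) ->
  {ae lebesgue_tuple R #|E|, forall x : #|E|.-tuple (measurableTypeR R),
     \det (mxsub h g (realization x)) != 0}.
Proof.
move=> h_inj g_inj hg.
apply: (@ae_realization _ _ _ (\det (mxsub h g (generic_mx R E)))
  (fun A => \det (mxsub h g A))).
  by move=> x; rewrite -det_map_mx map_mxsub map_generic_mx.
pose w e : R := \sum_k ((h k, g k) == e)%:R.
have [x xw] := realization_surj E w; exists x.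
suff -> : mxsub h g (realization x) = 1%:M by rewrite det1 oner_neq0.
apply/matrixP => k l; have := xw (h k) (g l); rewrite !mxE => ->.
rewrite /w (bigD1 k) //= big1 ?addr0 => [|i ik]; last first.
  by rewrite xpair_eqE (inj_eq h_inj) (negPf ik).
rewrite xpair_eqE eqxx (inj_eq g_inj) /=.
by case: eqVneq => [->|_]; rewrite ?hg // if_same.
Qed.

Lemma realization_edge (x : #|E|.-tuple R) i j :
  complex_realization x i j != 0 -> (i, j) \in E.
Proof. by rewrite !mxE; case: ifP => //; rewrite rmorph0 eqxx. Qed.

(** The rows outside the image of h are zero, so that A factors through the
    selection of the rows in this image. *)
Lemma cycle_cover_rows m (h : 'I_m.+1 -> 'I_n.+1) (s : {perm 'I_m.+1}) :
  injective h -> (forall k, (h k, h (s k)) \in E) ->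
  (forall i j, (i, j) \in E -> i \in codom h) ->
  E \in @structurally_diagonalizable R n.+1.
Proof.
move=> h_inj hs Eh; apply/mem_set; apply: filterS (ae_simple_spectrum h_inj hs) => x.
rewrite -(fmorph_eq0 RC) map_simple_spectrum map_mxsub => spec.
rewrite (trselect_rowsub h_inj (A := map_mx _ _)).
  by apply: diagonalizable_factor; rewrite mul_mx_trselect -mxsub_comp.
by move=> i j /realization_edge; exact: Eh.
Qed.

Lemma cycle_cover_cols m (h : 'I_m.+1 -> 'I_n.+1) (s : {perm 'I_m.+1}) :
  injective h -> (forall k, (h k, h (s k)) \in E) ->
  (forall i j, (i, j) \in E -> j \in codom h) ->
  E \in @structurally_diagonalizable R n.+1.
Proof.
move=> h_inj hs Eh; apply/mem_set; apply: filterS (ae_simple_spectrum h_inj hs) => x.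
rewrite -(fmorph_eq0 RC) map_simple_spectrum map_mxsub => spec.
rewrite (colsub_select h_inj (A := map_mx _ _)).
  by apply: diagonalizable_factor; rewrite mul_select_mx -mxsub_comp.
by move=> i j /realization_edge; exact: Eh.
Qed.

(** The matching makes the selected rows generically independent, while the zero
    column h k0 is also a column of the small matrix. *)
Lemma not_diagonalizable_rows m (h g : 'I_m -> 'I_n.+1) k0 :
  injective h -> injective g -> (forall k, (h k, g k) \in E) ->
  (forall i j, (i, j) \in E -> i \in codom h) ->
  (forall i, (i, h k0) \notin E) ->
  E \notin @structurally_diagonalizable R n.+1.
Proof.
move=> h_inj g_inj hg Eh E0; apply/negP => /set_mem aeD.
apply: (ae_contradiction aeD).
apply: filterS (ae_matching_minor h_inj g_inj hg) => x.
rewrite -(fmorph_eq0 RC) -det_map_mx map_mxsub => minor.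
rewrite (trselect_rowsub h_inj (A := map_mx _ _)); last first.
  by move=> i j /realization_edge; exact: Eh.
apply: not_diagonalizable_factor; first exact: row_full_trselect.
  move: minor; rewrite mxsubcr -mul_mx_trselect -unitfE => minor.
  have : row_free (rowsub h (complex_realization x) *m (select_mx _ g)^T).
    by rewrite row_free_unit unitmxE.
  by rewrite -!row_leq_rank => /leq_trans; apply; exact: mxrankM_maxl.
rewrite mul_mx_trselect -mxsub_comp -det_tr; apply/eqP/det0P.
exists (delta_mx 0 k0); first by apply/rV0Pn; exists k0; rewrite mxE !eqxx oner_neq0.
rewrite -rowE; apply/rowP => k; rewrite !mxE /=.
by rewrite (negPf (E0 _)) rmorph0.
Qed.

Lemma not_diagonalizable_cols m (h g : 'I_m -> 'I_n.+1) k0 :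
  injective h -> injective g -> (forall k, (g k, h k) \in E) ->
  (forall i j, (i, j) \in E -> j \in codom h) ->
  (forall j, (h k0, j) \notin E) ->
  E \notin @structurally_diagonalizable R n.+1.
Proof.
move=> h_inj g_inj gh Eh E0; apply/negP => /set_mem aeD.
apply: (ae_contradiction aeD).
apply: filterS (ae_matching_minor g_inj h_inj gh) => x.
rewrite -(fmorph_eq0 RC) -det_map_mx map_mxsub => minor.
rewrite (colsub_select h_inj (A := map_mx _ _)); last first.
  by move=> i j /realization_edge; exact: Eh.
apply: not_diagonalizable_factor; last 1 first.
- rewrite mul_select_mx -mxsub_comp; apply/eqP/det0P.
  exists (delta_mx 0 k0); first by apply/rV0Pn; exists k0; rewrite mxE !eqxx oner_neq0.
  rewrite -rowE; apply/rowP => k; rewrite !mxE /=.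
  by rewrite (negPf (E0 _)) rmorph0.
- move: minor; rewrite mxsubrc -mul_select_mx -unitfE => minor.
  have : row_full (select_mx _ g *m colsub h (complex_realization x)).
    by rewrite row_full_unit unitmxE.
  by rewrite -!col_leq_rank => /leq_trans; apply; exact: mxrankM_maxr.
- exact: row_free_select.
Qed.

End DiagonalizabilityCriteria.

Section FiniteSets.
Import mathcomp.boot.fintype mathcomp.boot.finset.
Local Close Scope classical_set_scope.

(** * Hall's marriage theorem *)

Section Hall.
Local Open Scope nat_scope.
Variables (T U : finType).

(** Rado's argument: as long as some N a contains two elements x and y, one of
    them can be removed. Otherwise there are sets S1 and S2 containing a that
    violate the condition after the removal of x and of y respectively, and
    counting the neighbours of S1 :|: S2 and of (S1 :&: S2) :\ a shows that
    one of these already violates the condition. *)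
Theorem hall_matching (N : T -> {set U}) (A : {set T}) (u0 : U) :
  (forall S : {set T}, S \subset A -> #|S| <= #|\bigcup_(a in S) N a|) ->
  exists f : T -> U, {in A &, injective f} /\ {in A, forall a, f a \in N a}.
Proof.
have [k] := ubnP (\sum_(a in A) #|N a|); elim: k N => // k IHk N ltk hallN.
have N1 a : a \in A -> 0 < #|N a|.
  move=> aA; have := hallN [set a]; rewrite cards1 big_set1; apply.
  by rewrite sub1set.
have [/existsP[a /andP[aA]]|] := boolP [exists a, (a \in A) && (1 < #|N a|)]; last first.
  rewrite negb_exists => /forallP small.
  have Na a : a \in A -> exists x, N a = [set x].
    move=> aA; apply/cards1P; rewrite eqn_leq N1 // andbT.
    by have := small a; rewrite aA /= -leqNgt.
  exists (fun a => odflt u0 [pick x in N a]); split; last first.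
    move=> a aA; case: pickP => //= N0; have := N1 a aA.
    by rewrite card_gt0 => /set0Pn[x]; rewrite N0.
  move=> a b aA bA; have [[x Nax] [y Nby]] := (Na a aA, Na b bA).
  case: pickP => /= [x'|/(_ x)]; last by rewrite Nax set11.
  case: pickP => /= [y'|/(_ y)]; last by rewrite Nby set11.
  rewrite Nax Nby !inE => /eqP-> /eqP-> xy.
  apply/eqP; apply: contraT => ab; have := hallN [set a; b].
  rewrite cards2 ab bigcup_setU !big_set1 Nax Nby xy setUid cards1.
  by apply; rewrite subUset !sub1set aA.
move=> /card_gt1P[x [y [xNa yNa xy]]].
pose del z b := if b == a then N b :\ z else N b.
have delS z b : del z b \subset N b by rewrite /del; case: eqP => // _; exact: subD1set.
have step z : z \in N a ->
    (forall S : {set T}, S \subset A -> #|S| <= #|\bigcup_(b in S) del z b|) ->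
    exists f : T -> U, {in A &, injective f} /\ {in A, forall b, f b \in N b}.
  move=> zNa /IHk[|f [f_inj fN]].
    rewrite -ltnS (leq_trans _ ltk) // ltnS [X in _ < X](bigD1 a) //=.
    rewrite [X in X < _](bigD1 a) //= {1}/del eqxx [X in _ < X + _](cardsD1 z) zNa.
    rewrite add1n addSn ltnS leq_add2l; apply: leq_sum => b _.
    exact: subset_leq_card.
  exists f; split=> // b /fN; exact: (subsetP (delS z b)).
have [|/forall_inPn[S1 S1A]] := boolP [forall S : {set T} in powerset A,
    #|S| <= #|\bigcup_(b in S) del x b|].
  move=> /forall_inP Hx; apply: (step x xNa) => S SA; apply: Hx.
  by rewrite powersetE.
rewrite -ltnNge => S1lt.
have [|/forall_inPn[S2 S2A]] := boolP [forall S : {set T} in powerset A,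
    #|S| <= #|\bigcup_(b in S) del y b|].
  move=> /forall_inP Hy; apply: (step y yNa) => S SA; apply: Hy.
  by rewrite powersetE.
rewrite -ltnNge => S2lt; exfalso; rewrite !powersetE in S1A S2A.
set X := \bigcup_(b in S1) _ in S1lt; set Y := \bigcup_(b in S2) _ in S2lt.
have viol_a z (S : {set T}) : S \subset A -> #|\bigcup_(b in S) del z b| < #|S| -> a \in S.
  move=> SA; apply: contraTT => aS; rewrite -leqNgt; apply: leq_trans (hallN S SA) _.
  apply: subset_leq_card; apply/bigcupsP => b bS.
  by rewrite (bigcup_max b) // /del; case: eqP => // ba; rewrite -ba bS in aS.
have aS1 := viol_a x S1 S1A S1lt; have aS2 := viol_a y S2 S2A S2lt.
have XY : \bigcup_(b in S1 :|: S2) N b \subset X :|: Y.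
  apply/bigcupsP => b bS; apply/subsetP => z zN; rewrite inE.
  have [ba|ba] := eqVneq b a; last first.
    move: bS; rewrite inE => /orP[bS|bS]; apply/orP; [left|right]; apply/bigcupP;
      exists b => //; by rewrite /del (negPf ba).
  have [zx|zx] := eqVneq z x; apply/orP; [right|left]; apply/bigcupP; exists a => //;
    by rewrite /del eqxx !inE -ba zN andbT ?zx.
have IXY : \bigcup_(b in (S1 :&: S2) :\ a) N b \subset X :&: Y.
  apply/bigcupsP => b; rewrite !inE => /and3P[ba bS1 bS2].
  rewrite subsetI; apply/andP; split; rewrite (bigcup_max b) // /del (negPf ba) //.
have SU : S1 :|: S2 \subset A by rewrite subUset S1A.
have SI : (S1 :&: S2) :\ a \subset A.
  by rewrite (subset_trans (subD1set _ _)) // (subset_trans (subsetIl _ _)).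
have le1 := leq_trans (hallN _ SU) (subset_leq_card XY).
have le2 := leq_trans (hallN _ SI) (subset_leq_card IXY).
have := cardsD1 a (S1 :&: S2); rewrite !inE aS1 aS2 => IE.
have := cardsUI X Y; have := cardsUI S1 S2; lia.
Qed.

End Hall.

(** * Matchings and cycle covers of a digraph without defects *)

Section ZeroPatterns.
Local Open Scope nat_scope.
Variable n : nat.
Implicit Types (E F : digraph n) (S T A : {set 'I_n}).

Definition out_nbrs E S := [set j | [exists i in S, (i, j) \in E]].

Definition zero_rows E := [set i | [forall j, (i, j) \notin E]].

Definition transpose E : digraph n := [set e | (e.2, e.1) \in E].

(** With a loop at every zero row, a perfect matching fixes the zero rows and
    permutes the other vertices: it is a cycle cover of the latter. *)
Definition patch E : digraph n := E :|: [set (i, i) | i in zero_rows E].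

(** The factor 3 leaves room for the union bounds: a deficient set of
    s <= n / 3 rows avoids at least 2 n / 3 columns. *)
Definition deficient E :=
  [exists S : {set 'I_n}, (3 * #|S| <= n) && (#|out_nbrs (patch E) S| < #|S|)].

Definition zero_block E :=
  [exists S : {set 'I_n}, exists T : {set 'I_n},
    [&& n < 3 * #|S|, n < 3 * #|T| & [forall i in S, forall j in T, (i, j) \notin E]]].

Definition isolated E := [exists i, i \in zero_rows E :&: zero_rows (transpose E)].

Lemma transposeK : involutive transpose.
Proof. by move=> E; apply/setP => -[i j]; rewrite !inE. Qed.

Lemma zero_rowP E i : reflect (forall j, (i, j) \notin E) (i \in zero_rows E).
Proof. by rewrite inE; exact: forallP. Qed.

Lemma out_nbrsP E S j :
  reflect (exists2 i, i \in S & (i, j) \in E) (j \in out_nbrs E S).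
Proof. by rewrite inE; apply: (iffP exists_inP). Qed.

Lemma in_patch E i j :
  ((i, j) \in patch E) = ((i, j) \in E) || (i == j) && (i \in zero_rows E).
Proof.
rewrite inE; congr (_ || _); apply/imsetP/andP => [[k kz [-> ->]]|[/eqP<- iz]] //.
by exists i.
Qed.

Lemma zero_block_transpose E : zero_block (transpose E) = zero_block E.
Proof.
suff imp E' : zero_block E' -> zero_block (transpose E').
  by apply/idP/idP => /imp //; rewrite transposeK.
case/existsP => S /existsP[T /and3P[Sn Tn ST]].
apply/existsP; exists T; apply/existsP; exists S; rewrite Sn Tn /=.
apply/forall_inP => i iT; apply/forall_inP => j jS; rewrite inE /=.
exact: (forall_inP (forall_inP ST j jS)).
Qed.

Lemma isolated_transpose E : isolated (transpose E) = isolated E.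
Proof. by rewrite /isolated transposeK setIC. Qed.

Lemma bigcup_out_nbrs E S :
  \bigcup_(i in S) [set j | (i, j) \in E] = out_nbrs E S.
Proof.
apply/setP => j; apply/bigcupP/out_nbrsP => -[i iS]; rewrite ?inE => ij; exists i => //.
by rewrite inE.
Qed.

(** When S violates Hall's condition for F, its non-neighbours T are zero
    against S. If S is small, this contradicts the hypothesis on small sets; if
    both are large, they form a zero block; if T is small, the nonzero columns
    in T meet only rows of A :\: S, and there are too few of those. *)
Lemma matching_exists E F A :
  E \subset F -> ~: A \subset zero_rows E ->
  #|zero_rows (transpose E)| + #|A| <= n ->
  (forall S, S \subset A -> 3 * #|S| <= n -> #|S| <= #|out_nbrs F S|) ->
  ~~ deficient (transpose E) -> ~~ zero_block E ->
  exists f : 'I_n -> 'I_n, {in A &, injective f} /\ {in A, forall a, (a, f a) \in F}.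
Proof.
move=> EF Azero JA smallA Tdef noblock.
have [A0|[a0 a0A]] := set_0Vmem A.
  by exists id; rewrite A0; split=> a; rewrite inE.
suff hallF S : S \subset A -> #|S| <= #|out_nbrs F S|.
  have [|f [f_inj fN]] := @hall_matching _ _ (fun i => [set j | (i, j) \in F]) A a0; last first.
    by exists f; split=> // a /fN; rewrite inE.
  by move=> S SA; rewrite bigcup_out_nbrs; exact: hallF.
move=> SA; rewrite leqNgt; apply/negP => Slt.
set J := zero_rows (transpose E) in JA.
pose T := ~: out_nbrs F S.
have cT : #|out_nbrs F S| + #|T| = n by rewrite cardsC card_ord.
have noF i j : i \in S -> j \in T -> (i, j) \notin F.
  by move=> iS; rewrite inE; apply: contra => ij; apply/out_nbrsP; exists i.
have [S3|S3] := leqP (3 * #|S|) n; first by have := smallA S SA S3; rewrite leqNgt Slt.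
have [T3|T3] := leqP (3 * #|T|) n; last first.
  move/negP: noblock; apply; apply/existsP; exists S; apply/existsP; exists T.
  rewrite S3 T3; apply/forall_inP => i iS; apply/forall_inP => j jT.
  by apply: contra (noF i j iS jT); exact: (subsetP EF).
(* zero columns are dropped because their loop would count as a neighbour *)
pose T1 := T :\: J.
have T1lt : #|A| - #|S| < #|T1|.
  have := cardsD T J; have := subset_leq_card (subsetIr T J); rewrite -/T1.
  have := subset_leq_card SA. lia.
have T1le : #|T1| <= #|out_nbrs (patch (transpose E)) T1|.
  rewrite leqNgt; apply: contra Tdef => T1def; apply/existsP; exists T1.
  by rewrite T1def andbT (leq_trans _ T3) // leq_mul2l subset_leq_card ?subsetDl.
suff : #|out_nbrs (patch (transpose E)) T1| <= #|A :\: S|.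
  have := cardsD A S; rewrite (setIidPr SA); lia.
apply: subset_leq_card; apply/subsetP => r /out_nbrsP[t].
rewrite inE => /andP[tJ tT]; rewrite in_patch (negPf tJ) andbF orbF inE /= => rt.
rewrite inE; apply/andP; split.
  by apply/negP => rS; have := noF r t rS tT; rewrite (subsetP EF).
apply: contraLR rt => rA; move: rA; rewrite -in_setC => /(subsetP Azero)/zero_rowP.
exact.
Qed.

Lemma not_deficient E S : ~~ deficient E -> 3 * #|S| <= n ->
  #|S| <= #|out_nbrs (patch E) S|.
Proof.
move=> nd S3; rewrite leqNgt; apply: contra nd => lt; apply/existsP; exists S.
by rewrite S3.
Qed.

(** The index type is 'I_m.+1 because square matrices form a ring with
    polynomial evaluation only in nonzero dimension. *)
Lemma ord_enumeration A : A != set0 ->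
  exists m (h : 'I_m.+1 -> 'I_n), injective h /\ codom h =i A.
Proof.
move=> /set0Pn[a aA]; have A0 : #|A| != 0 by rewrite cards_eq0; apply/set0Pn; exists a.
pose m := #|A|.-1; have mE : #|A| = m.+1 by rewrite /m prednK // lt0n.
exists m, (fun k => nth a (enum A) k); split.
  move=> k l /eqP; rewrite nth_uniq ?enum_uniq // -?cardE ?mE // => /eqP/val_inj //.
move=> x; apply/codomP/idP => [[k ->]|xA].
  by rewrite -mem_enum mem_nth // -cardE mE.
have ltx : index x (enum A) < m.+1 by rewrite -mE cardE index_mem mem_enum.
by exists (Ordinal ltx); rewrite /= nth_index // mem_enum.
Qed.

(** The cycle cover is a perfect matching of the patched digraph, restricted to
    the nonzero rows. *)
Lemma cycle_cover_exists E :
  0 < n ->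
  ~~ deficient E -> ~~ deficient (transpose E) -> ~~ zero_block E ->
  zero_rows (transpose E) = set0 ->
  exists m (h : 'I_m.+1 -> 'I_n) (s : {perm 'I_m.+1}),
   [/\ injective h, forall k, (h k, h (s k)) \in E
     & codom h =i ~: zero_rows E].
Proof.
move=> n0 ndE ndT nbE J0.
have [f [f_inj fP]] : exists f : 'I_n -> 'I_n,
    {in setT &, injective f} /\ {in setT, forall a, (a, f a) \in patch E}.
  apply: (@matching_exists E) => //; first exact: subsetUl.
  - by rewrite setCT sub0set.
  - by rewrite J0 cards0 cardsT card_ord.
  - by move=> S _ S3; exact: not_deficient.
have {}f_inj : injective f by move=> i j; apply: f_inj; rewrite in_setT.
have {}fP i : (i, f i) \in patch E by apply: fP; rewrite in_setT.
have [|m [h [h_inj hW]]] := @ord_enumeration (~: zero_rows E).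
  have /zero_rowP : Ordinal n0 \notin zero_rows (transpose E) by rewrite J0 inE.
  move=> /existsNP[j /negP]; rewrite negbK inE /= => jE.
  by apply/set0Pn; exists j; rewrite inE; apply/negP => /zero_rowP/(_ (Ordinal n0)); rewrite jE.
have fix_zero i : i \in zero_rows E -> f i = i.
  move=> iz; have := fP i; rewrite in_patch => /orP[|/andP[/eqP]//].
  by move/zero_rowP: iz => /(_ (f i))/negPf->.
have fW k : f (h k) \in codom h.
  rewrite hW inE; have : h k \in ~: zero_rows E by rewrite -hW codom_f.
  rewrite inE; apply: contra => fz; have /f_inj <- // := fix_zero _ fz.
pose t k := iinv (fW k).
have tE k : h (t k) = f (h k) by exact: f_iinv.
have t_inj : injective t by move=> k l /(congr1 h); rewrite !tE => /f_inj/h_inj.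
exists m, h, (perm t_inj); split=> // k; rewrite permE tE.
have := fP (h k); rewrite in_patch => /orP[//|/andP[_ zk]].
by have := codom_f h k; rewrite hW inE zk.
Qed.

Lemma row_matching_exists E :
  ~~ deficient E -> ~~ deficient (transpose E) -> ~~ zero_block E ->
  ~~ isolated E -> zero_rows (transpose E) != set0 ->
  #|zero_rows (transpose E)| <= #|zero_rows E| ->
  exists m (h g : 'I_m.+1 -> 'I_n) k0,
   [/\ injective h, injective g, forall k, (h k, g k) \in E,
     codom h =i ~: zero_rows E & h k0 \in zero_rows (transpose E)].
Proof.
move=> ndE ndT nbE niE /set0Pn[j0 j0J] JI.
have [f [f_inj fP]] : exists f : 'I_n -> 'I_n,
    {in ~: zero_rows E &, injective f} /\
    {in ~: zero_rows E, forall a, (a, f a) \in E}.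
  apply: (@matching_exists E) => //.
  - by rewrite setCK.
  - have : #|zero_rows E| + #|~: zero_rows E| = n by rewrite cardsC card_ord.
    by move=> cW; exact: leq_trans (leq_add JI (leqnn _)) (eq_leq cW).
  move=> S SW S3; apply: leq_trans (not_deficient ndE S3) _.
  apply: subset_leq_card; apply/subsetP => j /out_nbrsP[i iS].
  rewrite in_patch => /orP[ij|/andP[_ iz]]; first by apply/out_nbrsP; exists i.
  by have := subsetP SW _ iS; rewrite inE iz.
have j0W : j0 \in ~: zero_rows E.
  rewrite inE; apply: contra niE => j0I; apply/existsP; exists j0.
  by rewrite inE j0I.
have [|m [h [h_inj hW]]] := @ord_enumeration (~: zero_rows E).
  by apply/set0Pn; exists j0.
have hkW k : h k \in ~: zero_rows E by rewrite -hW codom_f.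
have /codomP[k0 k0E] : j0 \in codom h by rewrite hW.
exists m, h, (f \o h), k0; split=> //; last by rewrite -k0E.
  by move=> k l /= /f_inj kl; apply: h_inj; apply: kl.
by move=> k; exact: fP.
Qed.

Lemma codom_nonzero_rows E m (h : 'I_m -> 'I_n) :
  codom h =i ~: zero_rows E -> forall i j, (i, j) \in E -> i \in codom h.
Proof.
move=> hW i j ij; rewrite hW inE; apply/negP => /zero_rowP/(_ j).
by rewrite ij.
Qed.

End ZeroPatterns.

(** Deficiency has to be excluded for rows and for columns; the other two
    defects are invariant under transposition. *)
Definition exceptional n (E : digraph n) :=
  [|| deficient E, deficient (transpose E), zero_block E | isolated E].

(** Up to transposition, either there is no zero column and a cycle cover of the
    nonzero rows exists, or there are zero rows and zero columns and the nonzero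
    rows can be matched. *)
Lemma structurally_diagonalizableE (R : realType) n (E : digraph n.+1) :
  ~~ exceptional E ->
  (E \in @structurally_diagonalizable R n.+1) =
  (zero_rows E == set0) || (zero_rows (transpose E) == set0).
Proof.
rewrite !negb_or => /and4P[dE dT bE iE].
have [I0|I0] := eqVneq (zero_rows E) set0.
  have bT : ~~ zero_block (transpose E) by rewrite zero_block_transpose.
  have [m [h [s [h_inj hs hW]]]] : exists m (h : 'I_m.+1 -> 'I_n.+1) (s : {perm 'I_m.+1}),
      [/\ injective h, forall k, (h k, h (s k)) \in transpose E
        & codom h =i ~: zero_rows (transpose E)].
    by apply: cycle_cover_exists; rewrite ?transposeK.
  apply: (@cycle_cover_cols _ _ _ _ h s^-1%g h_inj) => [k|i j ij].
    by have := hs (s^-1%g k); rewrite permKV inE.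
  by apply: (codom_nonzero_rows hW (j := i)); rewrite inE.
have [J0|J0] := eqVneq (zero_rows (transpose E)) set0.
  have [m [h [s [h_inj hs hW]]]] := cycle_cover_exists (ltn0Sn n) dE dT bE J0.
  exact: (cycle_cover_rows R h_inj hs (codom_nonzero_rows hW)).
apply: negbTE; have [JI|/ltnW IJ] := leqP #|zero_rows (transpose E)| #|zero_rows E|.
  have [m [h [g [k0 [h_inj g_inj hg hW k0J]]]]] := row_matching_exists dE dT bE iE J0 JI.
  apply: (not_diagonalizable_rows R h_inj g_inj hg (codom_nonzero_rows hW)) => i.
  by move/zero_rowP: k0J => /(_ i); rewrite inE; exact.
have [m [h [g [k0 [h_inj g_inj hg hW k0J]]]]] : exists m (h g : 'I_m.+1 -> 'I_n.+1) k0,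
   [/\ injective h, injective g, forall k, (h k, g k) \in transpose E,
     codom h =i ~: zero_rows (transpose E) & h k0 \in zero_rows (transpose (transpose E))].
  apply: row_matching_exists; rewrite ?transposeK //.
  - by rewrite zero_block_transpose.
  - by rewrite isolated_transpose.
rewrite transposeK in k0J.
apply: (not_diagonalizable_cols R h_inj g_inj (k0 := k0)) => [k|i j ij|j].
- by have := hg k; rewrite inE.
- by apply: (codom_nonzero_rows hW (j := i)); rewrite inE.
- by move/zero_rowP: k0J => /(_ j).
Qed.

(** * Exact probabilities in the random digraph *)

Section RandomDigraph.
Variables (R : realType) (n : nat) (p : R).
Hypothesis p01 : 0 <= p <= 1.
Implicit Types (E F : digraph n) (P Q : pred (digraph n)).

Let p0 : 0 <= p. Proof. by case/andP: p01. Qed.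
Let q0 : 0 <= 1 - p. Proof. by rewrite subr_ge0; case/andP: p01. Qed.
Let q1 : 1 - p <= 1. Proof. by rewrite lerBlDr lerDl. Qed.

Definition weight E := \prod_e (if e \in E then p else 1 - p).

Definition Pr P := \sum_(E | P E) weight E.

Lemma weight_ge0 E : 0 <= weight E.
Proof. by apply: prodr_ge0 => e _; case: ifP. Qed.

Lemma Pr_ge0 P : 0 <= Pr P.
Proof. by apply: sumr_ge0 => E _; exact: weight_ge0. Qed.

Lemma eq_Pr P Q : P =1 Q -> Pr P = Pr Q.
Proof. by move=> PQ; apply: eq_bigl. Qed.

Lemma PrE P : Pr P = \sum_E weight E * (P E)%:R.
Proof.
by rewrite /Pr big_mkcond; apply: eq_bigr => E _; case: ifP; rewrite ?mulr1 ?mulr0.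
Qed.

Lemma Pr_sub P Q : (forall E, P E -> Q E) -> Pr P <= Pr Q.
Proof.
move=> PQ; rewrite !PrE; apply: ler_sum => E _; apply: ler_wpM2l; first exact: weight_ge0.
by have := PQ E; case: (P E) => [->//|_]; rewrite ler0n.
Qed.

Lemma Pr_predU P Q : Pr (fun E => P E || Q E) + Pr (fun E => P E && Q E) = Pr P + Pr Q.
Proof.
rewrite !PrE -!big_split /=; apply: eq_bigr => E _; rewrite -!mulrDr; congr (_ * _).
by case: (P E); case: (Q E); rewrite ?addr0 ?add0r.
Qed.

Lemma Pr_or_le P Q : Pr (fun E => P E || Q E) <= Pr P + Pr Q.
Proof. by rewrite -Pr_predU lerDl Pr_ge0. Qed.

Lemma Pr_exists_le (I : finType) (A : pred I) (P : I -> pred (digraph n)) :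
  Pr (fun E => [exists (i | A i), P i E]) <= \sum_(i | A i) Pr (P i).
Proof.
rewrite PrE; under [leRHS]eq_bigr do rewrite PrE.
rewrite exchange_big /=; apply: ler_sum => E _; rewrite -mulr_sumr.
apply: ler_wpM2l; first exact: weight_ge0.
case: existsP => [[i /andP[Ai Pi]]|_]; last by apply: sumr_ge0 => i _; rewrite ler0n.
by rewrite (bigD1 i) //= Pi lerDl sumr_ge0 // => j _; rewrite ler0n.
Qed.

(** Both sides are the expansion of a product over all pairs of a sum of two
    terms: the pair is an edge, or it is not. *)
Lemma Pr_avoid F : Pr (fun E => [disjoint E & F]) = (1 - p) ^+ #|F|.
Proof.
rewrite PrE -prodr_const [RHS]big_mkcond /=.
transitivity (\prod_e ((if e \in F then 0 else p) + (1 - p))).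
  rewrite bigA_distr; apply: eq_bigr => E _; rewrite /weight.
  have [EF|/pred0Pn[e /andP[eE eF]]] := boolP [disjoint E & F].
    rewrite mulr1; apply: eq_bigr => e _; case: ifP => // eE.
    by rewrite (disjointFr EF eE).
  by rewrite mulr0 (bigD1 e) //= [e \in E]eE [e \in F]eF mul0r.
by apply: eq_bigr => e _; case: ifP; rewrite ?add0r ?subrKC.
Qed.

(** Only an upper bound, so that F1 and F0 may overlap: the event is then
    empty. *)
Lemma Pr_pattern_le F1 F0 :
  Pr (fun E => (F1 \subset E) && [disjoint E & F0]) <= p ^+ #|F1| * (1 - p) ^+ #|F0|.
Proof.
have [/pred0Pn[e /andP[/= e1 e0]]|F10] := boolP (~~ [disjoint F1 & F0]).
  rewrite PrE big1 ?mulr_ge0 ?exprn_ge0 // => E _.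
  case: andP => [[F1E EF0]|_]; last by rewrite mulr0.
  by have := disjointFr EF0 (subsetP F1E _ e1); rewrite [_ \in _]e0.
rewrite negbK in F10.
pose a e := if e \in F0 then 0 else p; pose b e := if e \in F1 then 0 else 1 - p.
suff -> : Pr (fun E => (F1 \subset E) && [disjoint E & F0]) = \prod_e (a e + b e).
  rewrite -!prodr_const ![\prod_(i in _) _]big_mkcond -big_split /=.
  apply: ler_prod => e _; rewrite /a /b.
  have [eF1|eF1] := boolP (e \in F1); have [eF0|eF0] := boolP (e \in F0).
  - by have := disjointFr F10 eF1; rewrite eF0.
  - by rewrite addr0 mulr1 p0 lexx.
  - by rewrite add0r mul1r q0 lexx.
  - by rewrite subrKC mulr1 ler01 lexx.
rewrite bigA_distr PrE; apply: eq_bigr => E _; rewrite /weight.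
have [/andP[F1E EF0]|] := boolP (_ && _).
  rewrite mulr1; apply: eq_bigr => e _; rewrite /a /b; case: ifP => eE.
    by rewrite (disjointFr EF0 eE).
  by case: ifP => // eF1; rewrite (subsetP F1E _ eF1) in eE.
rewrite negb_and mulr0 => /orP[/subsetPn[e e1 eE]|/pred0Pn[e /andP[/= eE e0]]].
  by rewrite (bigD1 e) //= (negPf eE) /b e1 mul0r.
by rewrite (bigD1 e) //= [e \in E]eE /a [e \in F0]e0 mul0r.
Qed.

Lemma Pr_transpose P : Pr (fun E => P (transpose E)) = Pr P.
Proof.
rewrite [RHS](reindex_inj (inv_inj (@transposeK n))) /=; apply: eq_bigr => E _.
pose sw (e : 'I_n * 'I_n) := (e.2, e.1); have swK : involutive sw by case.
rewrite /weight (reindex_inj (inv_inj swK)) /=; apply: eq_bigr => e _.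
by rewrite inE.
Qed.

Definition cross (S T : {set 'I_n}) : digraph n :=
  [set e | (e.1 \in S) || (e.2 \in T)].

Lemma card_cross S T : #|cross S T| = (#|S| * n + (n - #|S|) * #|T|)%N.
Proof.
have -> : cross S T = setX S setT :|: setX (~: S) T.
  apply/setP => -[i j]; rewrite !inE /= andbT; case: (i \in S) => //=.
rewrite cardsU (_ : _ :&: _ = set0) ?cards0 ?subn0; last first.
  by apply/setP => -[i j]; rewrite !inE andbT andbA andbN.
by rewrite !cardsX cardsT card_ord [#|~: S|]cardsCs setCK card_ord.
Qed.

Lemma zero_rows_cross (S T : {set 'I_n}) E :
  (S \subset zero_rows E) && (T \subset zero_rows (transpose E)) =
  [disjoint E & cross S T].
Proof.
apply/andP/idP => [[SE TE]|ES].
  rewrite disjoint_subset; apply/subsetP => -[i j] ij; rewrite !inE negb_or /=.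
  apply/andP; split; apply/negP.
    by move/(subsetP SE)/zero_rowP/(_ j); rewrite ij.
  by move/(subsetP TE)/zero_rowP/(_ i); rewrite inE ij.
split; apply/subsetP => i iS; apply/zero_rowP => j; rewrite ?inE /=.
  by apply/negP => ij; have := disjointFr ES ij; rewrite inE /= iS.
by apply/negP => ij; have := disjointFr ES ij; rewrite inE /= iS orbT.
Qed.

(** Inclusion-exclusion, with S ranging over all sets of zero rows (or columns)
    when A is the set of those of a digraph. *)
Lemma indicator_empty (A : {set 'I_n}) :
  (A == set0)%:R = \sum_(S : {set 'I_n}) (-1) ^+ #|S| * (S \subset A)%:R :> R.
Proof.
transitivity (\prod_i (- (i \in A)%:R + 1) : R).
  have [->|/set0Pn[i iA]] := eqVneq A set0.
    by rewrite big1 // => i _; rewrite inE oppr0 add0r.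
  by rewrite (bigD1 i) //= iA addNr mul0r.
rewrite bigA_distr; apply: eq_bigr => S _.
rewrite -big_mkcond -prodr_const /=; have [SA|/subsetPn[i iS iA]] := boolP (S \subset A).
  by rewrite mulr1; apply: eq_bigr => i iS; rewrite (subsetP SA).
by rewrite mulr0 (bigD1 i) //= (negPf iA) oppr0 mul0r.
Qed.

Lemma sum_subsets_exp (x : R) : \sum_(S : {set 'I_n}) x ^+ #|S| = (x + 1) ^+ n.
Proof.
rewrite -[n in RHS]card_ord -prodr_const bigA_distr; apply: eq_bigr => S _.
by rewrite -big_mkcond -prodr_const.
Qed.

Lemma Pr_no_zero_row :
  Pr (fun E => zero_rows E == set0) = (1 - (1 - p) ^+ n) ^+ n.
Proof.
rewrite PrE; under eq_bigr do rewrite indicator_empty mulr_sumr.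
rewrite exchange_big /= addrC -sum_subsets_exp; apply: eq_bigr => S _.
under eq_bigr do rewrite mulrCA; rewrite -mulr_sumr.
rewrite [X in _ * X](_ : _ = Pr (fun E => [disjoint E & cross S set0])); last first.
  by rewrite PrE; apply: eq_bigr => E _; rewrite -zero_rows_cross sub0set andbT.
by rewrite Pr_avoid card_cross cards0 muln0 addn0 mulnC exprM -exprMn mulN1r.
Qed.

(** Inclusion-exclusion over the set S of rows and the set of columns; the sum
    over the columns is a binomial expansion, done here. *)
Lemma Pr_no_zero_row_col :
  Pr (fun E => (zero_rows E == set0) && (zero_rows (transpose E) == set0)) =
  \sum_(S : {set 'I_n}) (- (1 - p) ^+ n) ^+ #|S| * (1 - (1 - p) ^+ (n - #|S|)) ^+ n.
Proof.
rewrite PrE; under eq_bigr do rewrite -mulnb natrM !indicator_empty big_distrlr /= mulr_sumr.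
rewrite exchange_big /=; apply: eq_bigr => S _.
under eq_bigr do rewrite mulr_sumr.
rewrite exchange_big /= [1 - _ ^+ (n - _)]addrC -sum_subsets_exp mulr_sumr.
apply: eq_bigr => T _.
transitivity ((-1) ^+ #|S| * (-1) ^+ #|T| * Pr (fun E => [disjoint E & cross S T])).
  rewrite PrE mulr_sumr; apply: eq_bigr => E _.
  rewrite -zero_rows_cross -mulnb natrM; ring.
rewrite Pr_avoid card_cross exprD mulnC exprM exprM.
rewrite ![(- (_ ^+ _)) ^+ _]exprNn; ring.
Qed.

End RandomDigraph.

(** * Minimal deficient sets of rows *)

Section DeficiencyPattern.
Variable n : nat.
Implicit Types (E : digraph n) (S Z M N : {set 'I_n}).
Local Open Scope nat_scope.

(** Witnesses, for a neighbour v of S, of two elements of S from which v is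
    reached in the patched digraph. If v is in Z, the zero rows of S, one of
    them may be v itself through its loop, and a single edge is recorded, as a
    diagonal pair. *)
Definition hit_pairs S Z (v : 'I_n) : {set 'I_n * 'I_n} :=
  if v \in Z then [set ab | (ab.1 \in S) && (ab.2 == ab.1)]
  else [set ab | [&& ab.1 \in S, ab.2 \in S & ab.1 != ab.2]].

Definition hit_edges N (g : 'I_n -> 'I_n * 'I_n) : digraph n :=
  [set e | (e.2 \in N) && (e.1 \in [set (g e.2).1; (g e.2).2])].

(** What is forbidden by a set S with zero rows Z and with neighbours N in the
    patched digraph. *)
Definition avoided S Z N : digraph n := cross Z set0 :|: setX S (~: N).

(** Removing any vertex from an inclusion-minimal violating set S gives a set
    that satisfies Hall's condition. Hence S lacks exactly one neighbour, and
    every neighbour is still reached after the removal of one of its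
    predecessors. *)
Lemma minimal_deficient E : deficient E ->
  exists S, [/\ 3 * #|S| <= n, 1 < #|S|, #|out_nbrs (patch E) S|.+1 = #|S|
    & forall v, v \in out_nbrs (patch E) S -> exists a b,
      [/\ a \in S, b \in S, a != b, (a, v) \in patch E & (b, v) \in patch E]].
Proof.
move=> /existsP[S' viol].
have [S /minsetP[/andP[S3 Slt] Smin] _] := @minset_exists _ (fun S : {set 'I_n} =>
  (3 * #|S| <= n) && (#|out_nbrs (patch E) S| < #|S|)) S' viol.
have nbrsD1 r : r \in S -> #|S|.-1 <= #|out_nbrs (patch E) (S :\ r)|.
  move=> rS; have cS : #|S| = #|S :\ r|.+1 by rewrite (cardsD1 r S) rS.
  rewrite leqNgt; apply/negP => lt; rewrite cS /= in lt.
  have /setP/(_ r) : S :\ r = S.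
    apply: Smin (subD1set S r); rewrite lt andbT.
    by apply: leq_trans S3; rewrite leq_mul2l cS leqnSn orbT.
  by rewrite !inE eqxx rS.
have nbrsS (r : 'I_n) : out_nbrs (patch E) (S :\ r) \subset out_nbrs (patch E) S.
  apply/subsetP => j /out_nbrsP[i iS ij].
  by apply/out_nbrsP; exists i => //; case/setD1P: iS.
have [r0 r0S] : exists r, r \in S.
  by apply/set0Pn; rewrite -card_gt0; apply: leq_ltn_trans Slt.
have cN : #|out_nbrs (patch E) S|.+1 = #|S|.
  apply/eqP; rewrite eqn_leq Slt /= -[X in X <= _]prednK ?ltnS; last first.
    by rewrite card_gt0; apply/set0Pn; exists r0.
  exact: leq_trans (nbrsD1 r0 r0S) (subset_leq_card (nbrsS r0)).
exists S; split=> //.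
  rewrite -cN ltnS card_gt0; apply/set0Pn.
  have [z|] := boolP (r0 \in zero_rows E).
    by exists r0; apply/out_nbrsP; exists r0; rewrite // in_patch eqxx z orbT.
  rewrite inE => /forallPn[j]; rewrite negbK => rj.
  by exists j; apply/out_nbrsP; exists r0; rewrite // in_patch rj.
move=> v vN; have /out_nbrsP[a aS av] := vN.
have [/out_nbrsP[b bSa bv]|nv] := boolP (v \in out_nbrs (patch E) (S :\ a)).
  by case/setD1P: bSa => ba bS; exists b, a.
have := nbrsD1 a aS; rewrite -cN /= leqNgt => /negP[].
apply: proper_card; rewrite properE nbrsS; apply/subsetPn; by exists v.
Qed.

(** Z is the set of zero rows in S and Z :|: M is the set of its neighbours; a
    deficient digraph is thus found in a union of explicit patterns. *)
Lemma deficient_pattern E (i0 : 'I_n) : deficient E ->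
  exists S Z M, [/\ [&& 1 < #|S|, 3 * #|S| <= n, Z \subset S, [disjoint Z & M]
      & (#|Z| + #|M|).+1 == #|S|]
    & exists2 g : {ffun 'I_n -> 'I_n * 'I_n},
      g \in pfamily (i0, i0) (Z :|: M) (hit_pairs S Z)
      & (hit_edges (Z :|: M) g \subset E) && [disjoint E & avoided S Z (Z :|: M)]].
Proof.
case/minimal_deficient => S [S3 S1 cN hit].
set N := out_nbrs (patch E) S in cN hit.
pose Z := S :&: zero_rows E; pose M := N :\: Z.
have ZN : Z \subset N.
  apply/subsetP => v; rewrite inE => /andP[vS vz]; apply/out_nbrsP; exists v => //.
  by rewrite in_patch eqxx vz orbT.
have ZM : Z :|: M = N by rewrite /M setDE setUIr setUCr setIT (setUidPr ZN).
have dZM : [disjoint Z & M].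
  by rewrite -setI_eq0 /M setDE setICA setICr setI0.
exists S, Z, M; split.
  rewrite S1 S3 subsetIl dZM /= -cN eqSS -ZM cardsU.
  by move: dZM; rewrite -setI_eq0 => /eqP->; rewrite cards0 subn0.
have hitE v : v \in N -> exists ab, [&& ab \in hit_pairs S Z v, (ab.1, v) \in E & (ab.2, v) \in E].
  move=> /hit[a [b [aS bS ab av bv]]]; rewrite /hit_pairs.
  have [vZ|vZ] := boolP (v \in Z).
    have [c [cS cv vc]] : exists c, [/\ c \in S, (c, v) \in patch E & c != v].
      by have [av'|?] := eqVneq a v; [exists b; split=> //; rewrite -av' eq_sym|exists a].
    exists (c, c); rewrite inE cS eqxx /= andbb.
    by move: cv; rewrite in_patch (negPf vc) orbF.
  have inE' c : c \in S -> (c, v) \in patch E -> (c, v) \in E.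
    move=> cS; rewrite in_patch => /orP[//|/andP[/eqP cv cz]].
    by case/negP: vZ; rewrite -cv inE cS.
  by exists (a, b); rewrite inE /= aS bS ab !inE'.
rewrite ZM.
pose g := [ffun v => if v \in N then
   odflt (i0, i0) [pick ab in hit_pairs S Z v | ((ab.1, v) \in E) && ((ab.2, v) \in E)]
   else (i0, i0)].
have gP v : v \in N -> [&& g v \in hit_pairs S Z v, ((g v).1, v) \in E & ((g v).2, v) \in E].
  move=> vN; rewrite ffunE vN; case: pickP => [ab|none] //=.
  by have [ab abP] := hitE v vN; have := none ab; rewrite abP.
exists g.
  apply/pfamilyP; split; last by move=> v /gP/and3P[].
  by apply/supportP => v vN; rewrite ffunE (negPf vN).
apply/andP; split.
  apply/subsetP => -[a v]; rewrite inE /= => /andP[/gP/and3P[_ g1 g2]].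
  by rewrite !inE => /orP[]/eqP->.
rewrite disjoint_subset; apply/subsetP => -[i j] ij; rewrite !inE /= orbF.
have jN : i \in S -> j \in N.
  by move=> iS; apply/out_nbrsP; exists i; rewrite // in_patch ij.
rewrite negb_or !negb_and negbK; apply/andP; split.
  by apply/orP; right; apply/negP => /forallP/(_ j); rewrite ij.
by case: (boolP (i \in S)) => //= iS; have := jN iS; rewrite inE.
Qed.

Lemma card_hit_edges N (g : 'I_n -> 'I_n * 'I_n) :
  #|hit_edges N g| = \sum_(v in N) #|[set (g v).1; (g v).2]|.
Proof.
rewrite -sum1_card (partition_big (fun e : 'I_n * 'I_n => e.2) (mem N)) /=; last first.
  by move=> e; rewrite inE => /andP[].
apply: eq_bigr => v vN; rewrite sum1_card.
rewrite -(card_imset _ (_ : injective (fun a : 'I_n => (a, v)))); last by move=> a b [].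
apply: eq_card => -[a w]; rewrite unfold_in /=; apply/andP/imsetP => [[]|[b bg [-> ->]]].
  by rewrite inE => /andP[_ ag] /eqP wv; exists a; rewrite ?wv // -wv.
by rewrite inE /= vN bg eqxx.
Qed.

Lemma card_avoided S Z N : Z \subset S -> #|N| < #|S| ->
  #|S| * (n - #|S|) <= #|avoided S Z N|.
Proof.
move=> ZS NS.
have sub : setX S (~: N) \subset avoided S Z N by exact: subsetUr.
apply: leq_trans (subset_leq_card sub); rewrite cardsX leq_mul2l.
have cN : #|N| + #|~: N| = n by rewrite cardsC card_ord.
apply/orP; right; rewrite leq_subLR -[X in X <= _]cN.
by rewrite leq_add2r ltnW.
Qed.

(** Up to a factor exponential in s, the power s ^ m cancels the factorial in
    the binomial coefficient. *)
Lemma bin_exp_le s m k : m <= s -> 'C(k, m) * s ^ m <= k ^ m * 4 ^ s.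
Proof.
move=> ms.
have sm : s ^ m <= (s + m) ^_ m.
  rewrite ffact_prod -[m in _ ^ m]card_ord -prod_nat_const; apply: leq_prod => i _.
  have := ltn_ord i; lia.
have km : k ^_ m <= k ^ m.
  rewrite ffact_prod -[m in _ ^ m]card_ord -prod_nat_const; apply: leq_prod => i _.
  exact: leq_subr.
have c4 : 'C(s + m, m) <= 4 ^ s.
  rewrite (leq_trans (_ : _ <= 2 ^ (s + m))) //.
    have -> : 2 ^ (s + m) = \sum_(i < (s + m).+1) 'C(s + m, i).
      by rewrite -[2]/(1 + 1) Pascal; apply: eq_bigr => i _; rewrite !exp1n !muln1.
    by rewrite (bigD1 (inord m)) //= inordK ?ltnS ?leq_addl // leq_addr.
  by rewrite (_ : 4 = 2 ^ 2) // -expnM leq_exp2l //; lia.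
apply: leq_trans (leq_mul (leqnn _) sm) _.
by rewrite -bin_ffact mulnCA [leqLHS]mulnC bin_ffact leq_mul.
Qed.

End DeficiencyPattern.

(** * Exceptional digraphs are unlikely *)

Section BadEvents.
Variables (R : realType) (n : nat) (p : R).
Hypothesis p01 : 0 <= p <= 1.
Local Notation Pr := (@Pr R n p).
Local Notation L := (p * n%:R).
Implicit Types (E : digraph n) (S Z M N : {set 'I_n}).

Let p0 : 0 <= p. Proof. by case/andP: p01. Qed.
Let q0 : 0 <= 1 - p. Proof. by rewrite subr_ge0; case/andP: p01. Qed.

Lemma exp_onem_le k : (1 - p) ^+ k <= expR (- (p * k%:R)).
Proof.
rewrite -mulNr expRM_natr lerXn2r ?nnegrE ?expR_ge0 //.
exact: expR_ge1Dx.
Qed.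

Lemma Pr_isolated_le : Pr (@isolated n) <= n%:R * (1 - p) ^+ (n + n.-1).
Proof.
rewrite (eq_Pr _ (_ : _ =1 (fun E => [exists (i : 'I_n | true),
   [disjoint E & cross [set i] [set i]]]))); last first.
  move=> E; apply: eq_existsb => i /=.
  by rewrite -zero_rows_cross !sub1set inE.
apply: le_trans (Pr_exists_le _ _ _) _ => //.
under eq_bigr do rewrite Pr_avoid card_cross !cards1 mul1n muln1 subn1.
by rewrite sumr_const card_ord mulr_natl.
Qed.

Lemma Pr_zero_block_le :
  Pr (@zero_block n) <= 4 ^+ n * expR (- (p * n%:R ^+ 2 / 9)).
Proof.
pose big (ST : {set 'I_n} * {set 'I_n}) := (n < 3 * #|ST.1|)%N && (n < 3 * #|ST.2|)%N.
rewrite (eq_Pr _ (_ : _ =1 (fun E => [exists (ST | big ST),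
   [disjoint E & setX ST.1 ST.2]]))); last first.
  move=> E; apply/existsP/exists_inP => [[S /existsP[T /and3P[Sn Tn ST]]]|].
    exists (S, T); first by rewrite /big /= Sn.
    rewrite disjoint_subset; apply/subsetP => -[i j] ij; rewrite !inE /=.
    apply/negP => /andP[iS jT].
    by have := forall_inP (forall_inP ST i iS) j jT; rewrite ij.
  case=> -[S T] /andP[/= Sn Tn] ST; exists S; apply/existsP; exists T.
  rewrite Sn Tn; apply/forall_inP => i iS; apply/forall_inP => j jT.
  by apply/negP => ij; have := disjointFr ST ij; rewrite inE /= iS jT.
apply: le_trans (Pr_exists_le _ _ _) _ => //.
apply: le_trans (_ : \sum_(ST | big ST) expR (- (p * n%:R ^+ 2 / 9)) <= _).
  apply: ler_sum => -[S T] /andP[/= Sn Tn]; rewrite Pr_avoid cardsX.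
  apply: le_trans (exp_onem_le _) _; rewrite ler_expR lerN2 -mulrA ler_wpM2l //.
  rewrite ler_pdivrMr // -natrX -natrM ler_nat.
  have := leq_mul (ltnW Sn) (ltnW Tn); rewrite mulnn => /leq_trans; apply.
  by rewrite mulnACA mulnC.
rewrite sumr_const -[leLHS]mulr_natl ler_wpM2r ?expR_ge0 // -natrX ler_nat.
apply: leq_trans (max_card _) _.
by rewrite card_prod -cardsT -powersetT card_powerset cardsT card_ord -expnMn.
Qed.

(** Summing over the witnesses g is expanding a product over the neighbours: a
    neighbour in Z contributes |S| p and one in M at most (|S| p) ^ 2. *)
Lemma Pr_pattern_sum_le (i0 : 'I_n) S Z M :
  (3 * #|S| <= n)%N -> Z \subset S -> [disjoint Z & M] ->
  ((#|Z| + #|M|).+1 == #|S|)%N ->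
  Pr (fun E => [exists (g : {ffun 'I_n -> 'I_n * 'I_n} |
       g \in pfamily (i0, i0) (Z :|: M) (hit_pairs S Z)),
       (hit_edges (Z :|: M) g \subset E) && [disjoint E & avoided S Z (Z :|: M)]])
  <= (#|S|%:R * p) ^+ (#|Z| + #|M|.*2) * expR (- (2 / 3 * L)) ^+ #|S|.
Proof.
move=> S3 ZS ZM /eqP cS; set N := Z :|: M.
apply: le_trans (Pr_exists_le _ _ _) _ => //.
have qS : (1 - p) ^+ #|avoided S Z N| <= expR (- (2 / 3 * L)) ^+ #|S|.
  apply: le_trans (exp_onem_le _) _; rewrite -expRM_natl ler_expR mulrN lerN2.
  rewrite [leLHS](_ : _ = p * (#|S|%:R * (2 / 3 * n%:R))); last by ring.
  rewrite ler_wpM2l //.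
  have : (#|S| * (n - #|S|) <= #|avoided S Z N|)%N.
    apply: card_avoided => //; rewrite -cS ltnS cardsU leq_subLR.
    exact: leq_addl.
  rewrite -(ler_nat R); apply: le_trans; rewrite natrM ler_wpM2l //.
  by rewrite natrB; [move: S3; rewrite -(ler_nat R) natrM; lra|lia].
apply: (@le_trans _ _ (\sum_(g in pfamily (i0, i0) (mem N) (hit_pairs S Z))
    (\prod_(v in N) p ^+ #|[set (g v).1; (g v).2]|) * expR (- (2 / 3 * L)) ^+ #|S|)).
  apply: ler_sum => g _; apply: le_trans (Pr_pattern_le _ _ _) _ => //.
  rewrite card_hit_edges -prodrXr ler_wpM2l //.
  by apply: prodr_ge0 => v _; exact: exprn_ge0.
rewrite -mulr_suml ler_wpM2r ?exprn_ge0 ?expR_ge0 //.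
rewrite -(big_distr_big_dep _ _ _ (fun v (ab : 'I_n * 'I_n) => p ^+ #|[set ab.1; ab.2]|)) /=.
have big_N (F : 'I_n -> R) :
    \prod_(v in N) F v = \prod_(v in Z) F v * \prod_(v in M) F v.
  by rewrite -bigU //=; apply: eq_bigl => v; rewrite !inE.
rewrite big_N exprD; apply: ler_pM.
- by apply: prodr_ge0 => v _; apply: sumr_ge0 => ab _; exact: exprn_ge0.
- by apply: prodr_ge0 => v _; apply: sumr_ge0 => ab _; exact: exprn_ge0.
- rewrite -prodr_const; apply: ler_prod => v vZ; apply/andP; split.
    by apply: sumr_ge0 => ab _; exact: exprn_ge0.
  rewrite /hit_pairs vZ.
  rewrite (_ : [set _ | _] = [set (a, a) | a in S]); last first.
    apply/setP => -[a b]; rewrite inE /=; apply/andP/imsetP => [[aS /eqP->]|[d dS [-> ->]]] //.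
    by exists a.
  rewrite big_imset /=; last by move=> a b _ _ [].
  by under eq_bigr do rewrite setUid cards1; rewrite sumr_const mulr_natl.
- rewrite -mul2n exprM -prodr_const; apply: ler_prod => v vM; apply/andP; split.
    by apply: sumr_ge0 => ab _; exact: exprn_ge0.
  have vZ : v \notin Z by rewrite (disjointFl ZM vM).
  rewrite /hit_pairs (negPf vZ).
  apply: (@le_trans _ _ (\sum_(ab in setX S S) p ^+ 2)); last first.
    by rewrite sumr_const cardsX exprMn -natrX mulr_natl.
  rewrite big_mkcond [leRHS]big_mkcond; apply: ler_sum => -[a b] _ /=.
  rewrite -[_ (a, b)]/((a, b) \in [set ab | _]) !inE /=.
  case: (a \in S); case: (b \in S) => /=; rewrite ?lexx //.
  by case: ifP => ab; rewrite ?cards2 ?ab ?exprn_ge0 ?lexx.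
Qed.

(** A violating set of size s comes with 'C(n, s) choices of S, at most 2 ^ s
    choices of Z, and 'C(n, m) choices of M. By [bin_exp_le] these numbers
    absorb the powers of s in [Pr_pattern_sum_le]; the powers of n and p that
    remain are n * L ^ (s - 1 + m) with m < s, where L = p * n. *)
Lemma Pr_deficient_le : 1 <= L ->
  Pr (@deficient n) <=
  \sum_(s < n.+1 | (1 < s)%N) n%:R * (32 * L ^+ 2 * expR (- (2 / 3 * L))) ^+ s.
Proof.
move=> L1; set b := expR _; have b0 : 0 <= b by exact: expR_ge0.
have L0 : 0 <= L by rewrite (le_trans _ L1).
have LX m k : (m <= k)%N -> L ^+ m <= L ^+ k by exact: ler_weXn2l.
have [n0|n0] := posnP n; first by move: L1; rewrite n0 mulr0 ler10.
pose i0 := Ordinal n0.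
pose big S := (1 < #|S|)%N && (3 * #|S| <= n)%N.
pose fits S Z M := [disjoint Z & M] && ((#|Z| + #|M|).+1 == #|S|)%N.
have le1 : Pr (@deficient n) <= \sum_(S | big S) \sum_(Z : {set 'I_n} | Z \subset S)
    \sum_(M | fits S Z M) (#|S|%:R * p) ^+ (#|Z| + #|M|.*2) * b ^+ #|S|.
  apply: (@le_trans _ _ (Pr (fun E => [exists (S | big S), [exists (Z : {set 'I_n} | Z \subset S),
      [exists (M | fits S Z M), [exists (g : {ffun 'I_n -> 'I_n * 'I_n} |
       g \in pfamily (i0, i0) (Z :|: M) (hit_pairs S Z)),
       (hit_edges (Z :|: M) g \subset E) &&
       [disjoint E & avoided S Z (Z :|: M)]]]]]))).
    apply: Pr_sub => // E /(deficient_pattern i0)[S [Z [M [/and5P[S1 S3 ZS ZM cS] [g gF gE]]]]].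
    apply/exists_inP; exists S; first by rewrite /big S1.
    apply/exists_inP; exists Z => //.
    apply/exists_inP; exists M; first by rewrite /fits ZM.
    by apply/exists_inP; exists g.
  apply: le_trans (Pr_exists_le _ _ _) _ => //; apply: ler_sum => S /andP[S1 S3].
  apply: le_trans (Pr_exists_le _ _ _) _ => //; apply: ler_sum => Z ZS.
  apply: le_trans (Pr_exists_le _ _ _) _ => //; apply: ler_sum => M /andP[ZM cS].
  exact: Pr_pattern_sum_le.
apply: le_trans le1 _; apply: (@le_trans _ _ (\sum_(S | big S)
    (#|S|%:R * p) ^+ #|S|.-1 * (8 * L * b) ^+ #|S|)).
  apply: ler_sum => S /andP[S1 _]; set s := #|S|.
  have sp0 : 0 <= s%:R * p by rewrite mulr_ge0.
  apply: (@le_trans _ _ (\sum_(Z : {set 'I_n} | Z \subset S)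
      (s%:R * p) ^+ s.-1 * (4 * L * b) ^+ s)); last first.
    rewrite sumr_const -[leLHS]mulr_natl mulrCA ler_wpM2l ?exprn_ge0 //.
    rewrite (_ : 8 * L * b = 2 * (4 * L * b)); last by ring.
    rewrite [leRHS]exprMn ler_wpM2r ?exprn_ge0 ?mulr_ge0 // -natrX ler_nat.
    rewrite -card_powerset; apply: subset_leq_card; apply/subsetP => Z.
    by rewrite powersetE unfold_in.
  apply: ler_sum => Z ZS; set k := #|Z|; pose m := (s.-1 - k)%N.
  (* if Z is all of S, its loops already give |S| neighbours: no M fits *)
  have [ks|sk] := leqP s k.
    rewrite big1 ?mulr_ge0 ?exprn_ge0 ?mulr_ge0 // => M /andP[_ /eqP].
    by rewrite -/s -/k; lia.
  have mE M : fits S Z M -> #|M| = m by move=> /andP[_ /eqP]; rewrite -/s -/k /m; lia.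
  apply: (@le_trans _ _ (\sum_(M in [set M : {set 'I_n} | #|M| == m])
      (s%:R * p) ^+ s.-1 * ((s%:R * p) ^+ m * b ^+ s))).
    rewrite big_mkcond [leRHS]big_mkcond; apply: ler_sum => M _; rewrite inE.
    case: ifP => [/mE cM|_].
      rewrite cM eqxx -/k mulrA -exprD (_ : (k + m.*2 = s.-1 + m)%N) //.
      by rewrite /m -addnn; lia.
    by case: ifP => // _; rewrite !mulr_ge0 ?exprn_ge0.
  rewrite sumr_const card_draws card_ord -[leLHS]mulr_natl mulrCA ler_wpM2l ?exprn_ge0 //.
  rewrite [in leRHS]exprMn [leLHS]mulrA ler_wpM2r ?exprn_ge0 // [in leLHS]exprMn [leLHS]mulrA -natrX -natrM.
  apply: (@le_trans _ _ ((n ^ m * 4 ^ s)%:R * p ^+ m)).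
    rewrite ler_wpM2r ?exprn_ge0 // ler_nat; apply: bin_exp_le; rewrite /m; lia.
  rewrite natrM !natrX mulrAC -exprMn [n%:R * p]mulrC exprMn [leLHS]mulrC.
  by rewrite -exprMn [leRHS]exprMn ler_wpM2l ?exprn_ge0 // LX // /m; lia.
pose F (s : nat) := (s%:R * p) ^+ s.-1 * (8 * L * b) ^+ s.
have F0 s : 0 <= F s by rewrite /F !mulr_ge0 ?exprn_ge0 ?mulr_ge0.
have ltS S : (#|S| < n.+1)%N by rewrite ltnS -[leqRHS]card_ord max_card.
rewrite (partition_big (fun S => Ordinal (ltS S)) (fun s : 'I_n.+1 => 1 < s)%N) /=; last first.
  by move=> S /andP[].
apply: ler_sum => s s1.
apply: (@le_trans _ _ (\sum_(S in [set S : {set 'I_n} | #|S| == s]) F s)).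
  rewrite big_mkcond [leRHS]big_mkcond; apply: ler_sum => S _; rewrite inE.
  case: ifP => [/andP[_ /eqP sE]|_]; last by case: ifP.
  by rewrite -sE /= eqxx.
rewrite sumr_const card_draws card_ord -[leLHS]mulr_natl /F mulrA.
rewrite (_ : 32 * L ^+ 2 * b = (4 * L) * (8 * L * b)); last by ring.
rewrite [in leRHS]exprMn [leRHS]mulrA ler_wpM2r ?exprn_ge0 ?mulr_ge0 //.
case: {F F0} (nat_of_ord s) s1 => // k _ /=.
apply: (@le_trans _ _ (('C(n, k.+1) * k.+1 ^ k.+1)%:R * p ^+ k)).
  rewrite exprMn mulrA natrM natrX ler_wpM2r ?exprn_ge0 // ler_wpM2l //.
  by rewrite -!natrX ler_nat leq_pexp2l.
apply: (@le_trans _ _ ((n ^ k.+1 * 4 ^ k.+1)%:R * p ^+ k)).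
  by rewrite ler_wpM2r ?exprn_ge0 // ler_nat bin_exp_le.
rewrite natrM !natrX exprMn mulrCA.
rewrite [leLHS](_ : _ = 4 ^+ k.+1 * (n%:R * L ^+ k)); last first.
  by rewrite exprMn exprS; ring.
by rewrite !ler_wpM2l ?exprn_ge0 // LX.
Qed.

End BadEvents.

(** * Comparison with the absence of zero rows or columns *)

Definition no_zero_line n (E : digraph n) :=
  (zero_rows E == set0) || (zero_rows (transpose E) == set0).

Section ProbabilityEstimates.
Variables (R : realType) (n : nat) (p : R).
Hypothesis p01 : 0 <= p <= 1.
Local Notation q := (1 - p).

Let q0 : 0 <= q. Proof. by rewrite subr_ge0; case/andP: p01. Qed.
Let q1 : q <= 1. Proof. by case/andP: p01; lra. Qed.

Lemma gnp_probE (D : set (digraph n)) : gnp_prob p D = Pr p (fun E => E \in D).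
Proof. by []. Qed.

(** The two events coincide outside the exceptional digraphs. *)
Lemma gnp_prob_dist :
  (0 < n)%N ->
  `|gnp_prob p (@structurally_diagonalizable R n) - Pr p (@no_zero_line n)|
     <= Pr p (@exceptional n).
Proof.
move=> n0; rewrite gnp_probE; have DE (E : digraph n) : ~~ exceptional E ->
    (E \in @structurally_diagonalizable R n) = no_zero_line E.
  by case: n n0 E => // m _ E; exact: (@structurally_diagonalizableE R).
have le (P Q : pred (digraph n)) : (forall E, ~~ exceptional E -> P E = Q E) ->
    Pr p P <= Pr p Q + Pr p (@exceptional n).
  move=> PQ; apply: le_trans (Pr_or_le p01 _ _); apply: Pr_sub => // E PE.
  by case: (boolP (exceptional E)) => [|/PQ <-]; rewrite ?orbT // PE.
rewrite ler_distl lerBlDr; apply/andP; split; apply: le => E /DE //.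
Qed.

Lemma subX_le (x y : R) k : 0 <= y -> y <= x -> x ^+ k - y ^+ k <= k%:R * (x - y) * x ^+ k.-1.
Proof.
move=> y0 yx; have x0 := le_trans y0 yx.
rewrite subrXX [k%:R * _]mulrC -mulrA ler_wpM2l ?subr_ge0 //.
have -> : k%:R * x ^+ k.-1 = \sum_(i < k) x ^+ k.-1.
  by rewrite sumr_const card_ord mulr_natl.
apply: ler_sum => i _; have ik := ltn_ord i.
have -> : x ^+ k.-1 = x ^+ (k.-1 - i) * x ^+ i by rewrite -exprD subnK //; lia.
by rewrite ler_pM ?exprn_ge0 // lerXn2r.
Qed.

(** Replacing n - |S| by n in the inclusion-exclusion formula makes the two
    events independent. The error of each term is bounded linearly, and the
    bounds sum up to a difference of two binomial expansions. *)
Lemma Pr_no_zero_row_col_dist :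
  `|Pr p (fun E : digraph n => (zero_rows E == set0) && (zero_rows (transpose E) == set0))
     - ((1 - q ^+ n) ^+ n) ^+ 2|
  <= n%:R * q ^+ n * ((1 + q ^+ n.-1) ^+ n - (1 + q ^+ n) ^+ n).
Proof.
have sumX (x : R) : (1 + x) ^+ n = \sum_(S : {set 'I_n}) x ^+ #|S|.
  by rewrite sum_subsets_exp addrC.
rewrite Pr_no_zero_row_col // expr2 [X in _ - X * _]sumX mulr_suml -sumrB.
rewrite (sumX (q ^+ n.-1)) (sumX (q ^+ n)) -sumrB mulr_sumr.
apply: le_trans (ler_norm_sum _ _ _) _; apply: ler_sum => S _.
have sn : (#|S| <= n)%N by rewrite -[leqRHS]card_ord max_card.
rewrite -mulrBr normrM normrX normrN (ger0_norm (exprn_ge0 n q0)).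
have qX k : q ^+ k <= 1 by rewrite exprn_ile1.
have qle : q ^+ n <= q ^+ (n - #|S|) by rewrite ler_wiXn2l // leq_subr.
apply: (@le_trans _ _ ((q ^+ n) ^+ #|S| * (n%:R * (q ^+ (n - #|S|) - q ^+ n)))).
  rewrite ler_wpM2l ?exprn_ge0 // distrC ger0_norm; last first.
    by rewrite subr_ge0 lerXn2r ?nnegrE ?subr_ge0 // lerB.
  apply: le_trans (subX_le _ _ _) _; rewrite ?subr_ge0 ?lerB //.
  rewrite (_ : 1 - q ^+ n - _ = q ^+ (n - #|S|) - q ^+ n); last by ring.
  rewrite -[leRHS]mulr1 ler_wpM2l ?mulr_ge0 ?subr_ge0 //.
  by rewrite exprn_ile1 ?subr_ge0 ?lerBlDr ?lerDl ?exprn_ge0.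
rewrite -mulrA mulrCA ler_wpM2l // !mulrBr [(q ^+ n) ^+ #|S| * q ^+ n]mulrC lerD2r.
rewrite -!exprM -!exprD (_ : n * #|S| + (n - #|S|) = n + n.-1 * #|S|)%N //.
move: (#|S|) sn => s; case: (n) => [|m] /=; first by rewrite leqn0 => /eqP->.
by rewrite mulSn; move: (m * s)%N => k; lia.
Qed.

End ProbabilityEstimates.

End FiniteSets.

(** * Limits at the threshold *)

Section PowerLimits.
Variable R : realType.

Lemma near_pos_nat : \forall n \near \oo, (0 < n)%N.
Proof. by exists 1%N. Qed.

(** The usual upper bound, applied to 1 / (1 + x) = 1 - x / (1 + x). *)
Lemma expX_onep_ge (x : R) n : -1 < x -> expR (n%:R * x / (1 + x)) <= (1 + x) ^+ n.
Proof.
move=> x1; have x10 : 0 < 1 + x by rewrite -ltrBlDl sub0r.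
rewrite -mulrA expRM_natl lerXn2r ?nnegrE ?expR_ge0 ?(ltW x10) //.
rewrite -lef_pV2 ?posrE ?expR_gt0 // -expRN; apply: le_trans (expR_ge1Dx _).
by rewrite -[X in X - _](divff (lt0r_neq0 x10)) -mulrBl addrK mul1r.
Qed.

Lemma expX_onep_le (x : R) n : -1 < x -> (1 + x) ^+ n <= expR (n%:R * x).
Proof.
move=> x1; have x10 : 0 < 1 + x by rewrite -ltrBlDl sub0r.
by rewrite expRM_natl lerXn2r ?nnegrE ?expR_ge0 ?(ltW x10) // expR_ge1Dx.
Qed.

Lemma cvg_expX_onep (x : nat -> R) a :
  x n @[n --> \oo] --> 0 -> n%:R * x n @[n --> \oo] --> a ->
  (1 + x n) ^+ n @[n --> \oo] --> expR a.
Proof.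
move=> x0 nx; have c1 : 1 + x n @[n --> \oo] --> (1 + 0 : R).
  by apply: cvgD => //; exact: cvg_cst.
apply: (squeeze_cvgr (f := fun n => expR (n%:R * x n / (1 + x n)))
   (h := fun n => expR (n%:R * x n))).
- apply: filterS (cvgr_gt _ x0 (-1) (ltrN10 R)) => n xn.
  by rewrite expX_onep_ge // expX_onep_le.
- apply: continuous_cvg; first exact: continuous_expR.
  rewrite -[a]mulr1 -[X in a * X]invr1 -[X in a * X^-1]addr0.
  by apply: cvgM => //; apply: cvgV => //; rewrite addr0 oner_neq0.
- by apply: continuous_cvg => //; exact: continuous_expR.
Qed.

(** The term of degree k + 1 of the exponential series dominates. *)
Lemma cvg_expX_decay k (a : R) : 0 < a ->
  x ^+ k * expR (- (a * x)) @[x --> +oo] --> (0 : R).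
Proof.
move=> a0; pose C : R := (k.+1)`!%:R / a ^+ k.+1.
have inv0 : C * x^-1 @[x --> +oo] --> (0 : R).
  rewrite -[X in _ --> X](mulr0 C); apply: cvgM; first exact: cvg_cst.
  by apply/gtr0_cvgV0 => //; exact: nbhs_pinfty_gt.
apply: (squeeze_cvgr (f := fun=> 0)  _ (cvg_cst _) inv0).
apply: filterS (nbhs_pinfty_gt (real0 R)) => x x0; apply/andP; split.
  by rewrite mulr_ge0 ?exprn_ge0 ?expR_ge0 ?ltW.
rewrite expRN ler_pdivrMr ?expR_gt0 //.
have := expR_ge1Dxn k (ltW (mulr_gt0 a0 x0)).
move=> /(le_trans _) h; have {}h : (a * x) ^+ k.+1 / (k.+1)`!%:R <= expR (a * x).
  by apply: h; rewrite lerDr.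
have Cx : 0 <= C * x^-1.
  by rewrite /C !mulr_ge0 ?invr_ge0 ?exprn_ge0 ?ltW.
apply: le_trans (ler_wpM2l Cx h); rewrite /C exprMn le_eqVlt; apply/orP; left.
have f0 : (k.+1)`!%:R != 0 :> R by rewrite pnatr_eq0 -lt0n fact_gt0.
have x0' := lt0r_neq0 x0; have ak : a ^+ k.+1 != 0 by rewrite expf_neq0 ?lt0r_neq0.
apply/eqP; rewrite [x ^+ k.+1]exprS; move: (_ ^+ k.+1) (_%:R) (x ^+ k) ak f0 => A f X A0 f0.
by field; rewrite f0 x0' A0.
Qed.

Lemma sum_geometric_tail (b : R) n : 0 <= b <= 2^-1 ->
  \sum_(s < n | (1 < s)%N) b ^+ s <= 2 * b ^+ 2.
Proof.
move=> /andP[b0 b2]; suff : \sum_(s < n | (1 < s)%N) b ^+ s + 2 * b ^+ maxn n 2 <= 2 * b ^+ 2.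
  by apply: le_trans; rewrite lerDl mulr_ge0 ?exprn_ge0.
elim: n => [|n IHn]; first by rewrite big_ord0 add0r.
rewrite big_mkcond big_ord_recr /= -big_mkcond; apply: le_trans IHn.
rewrite -addrA lerD2l; have [n1|n1] := ltnP 1 n; last first.
  by rewrite add0r (maxn_idPr _) // (maxn_idPr _) // ltnW.
rewrite (maxn_idPl _); last exact: ltnW.
rewrite (maxn_idPl _) // exprS.
suff : 0 <= b ^+ n * (1 - 2 * b) by lra.
by rewrite mulr_ge0 ?exprn_ge0 // subr_ge0; lra.
Qed.

End PowerLimits.

Section ThresholdLimits.
Variables (R : realType) (c : R) (p eps : nat -> R).
Hypothesis pE : forall n, (0 < n)%N -> p n = (ln n%:R + c + eps n) / n%:R.
Hypothesis eps0 : eps n @[n --> \oo] --> (0 : R).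

Local Notation L n := (p n * n%:R).
Local Notation lam := (expR (- c)).

Lemma meanE n : (0 < n)%N -> L n = ln n%:R + c + eps n.
Proof. by move=> n0; rewrite pE // divfK // pnatr_eq0 -lt0n. Qed.

(** This expresses n through the mean degree L n, so that all the bounds become
    functions of L n, which tends to infinity. *)
Lemma natE n : (0 < n)%N -> n%:R = expR (L n) * expR (- c - eps n).
Proof.
move=> n0; rewrite -expRD meanE // (_ : _ + _ = ln n%:R); last by ring.
by rewrite lnK // posrE ltr0n.
Qed.

Lemma cvg_expR_shift : expR (- c - eps n) @[n --> \oo] --> lam.
Proof.
apply: continuous_cvg; first exact: continuous_expR.
rewrite -[X in _ --> X]subr0; apply: cvgB => //; exact: cvg_cst.
Qed.

Lemma cvg_mean : L n @[n --> \oo] --> +oo.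
Proof.
apply/cvgryPge => A.
have e1 : \forall n \near \oo, -1 < eps n by exact: cvgr_gt _ eps0 _ (ltrN10 R).
have n1 : \forall n \near \oo, expR (A - c + 1) <= n%:R :> R.
  by have /cvgryPge := @cvgr_idn R; exact.
near=> n.
have n0 : (0 < n)%N by near: n; exact: near_pos_nat.
rewrite meanE //.
have : A - c + 1 <= ln n%:R.
  rewrite -[leLHS]expRK ler_ln ?posrE ?expR_gt0 ?ltr0n //; by near: n.
have : -1 < eps n by near: n.
lra.
Unshelve. all: by end_near. Qed.

Lemma cvg_mean_decay k a : 0 < a -> L n ^+ k * expR (- (a * L n)) @[n --> \oo] --> (0 : R).
Proof. by move=> a0; exact: (cvg_comp _ _ cvg_mean (cvg_expX_decay k a0)). Qed.

Lemma cvg_meanX_div k : L n ^+ k / n%:R @[n --> \oo] --> (0 : R).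
Proof.
have h : L n ^+ k * expR (- (1 * L n)) * (expR (- c - eps n))^-1 @[n --> \oo] --> (0 : R).
  rewrite -[X in _ --> X](mul0r lam^-1); apply: cvgM; first exact: cvg_mean_decay.
  by apply: cvgV; [rewrite gt_eqF ?expR_gt0|exact: cvg_expR_shift].
apply: cvg_trans h; apply: near_eq_cvg.
near=> n; have n0 : (0 < n)%N by near: n; exact: near_pos_nat.
have -> : (n%:R : R)^-1 = expR (- L n) * (expR (- c - eps n))^-1.
  by rewrite {1}natE // invfM expRN.
by rewrite mul1r mulrA.
Unshelve. all: by end_near. Qed.

Lemma cvg_p : p n @[n --> \oo] --> (0 : R).
Proof.
apply: cvg_trans (cvg_meanX_div 1); apply: near_eq_cvg.
near=> n; have n0 : (0 < n)%N by near: n; exact: near_pos_nat.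
by rewrite expr1 mulfK // pnatr_eq0 -lt0n.
Unshelve. all: by end_near. Qed.

Lemma cvg_mean_sqr : L n * p n @[n --> \oo] --> (0 : R).
Proof.
apply: cvg_trans (cvg_meanX_div 2); apply: near_eq_cvg.
near=> n; have n0 : (0 < n)%N by near: n; exact: near_pos_nat.
by rewrite expr2 -mulrA mulfK // pnatr_eq0 -lt0n.
Unshelve. all: by end_near. Qed.

Lemma near_p_half : \forall n \near \oo, p n < 2^-1.
Proof. by apply: cvgr_lt cvg_p _ _; rewrite invr_gt0. Qed.

(** The expected number of zero rows converges: n q ^ n lies between the values
    given by [expX_onep_ge] and [expX_onep_le], whose ratio tends to 1 because
    L n * p n = (L n) ^ 2 / n tends to 0. *)
Lemma cvg_zero_rows : n%:R * (1 - p n) ^+ n @[n --> \oo] --> lam.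
Proof.
have lo : expR (- c - eps n) * expR (- (L n * p n / (1 - p n))) @[n --> \oo] --> lam.
  rewrite [X in _ --> X](_ : _ = lam * expR (- (0 * (1 - 0)^-1))); last first.
    by rewrite mul0r oppr0 expR0 mulr1.
  apply: cvgM; first exact: cvg_expR_shift.
  apply: continuous_cvg; first exact: continuous_expR.
  apply: cvgN; apply: cvgM; first exact: cvg_mean_sqr.
  apply: cvgV; first by rewrite subr0 oner_neq0.
  by apply: cvgB; [exact: cvg_cst|exact: cvg_p].
apply: squeeze_cvgr lo cvg_expR_shift.
near=> n; have n0 : (0 < n)%N by near: n; exact: near_pos_nat.
have ph : p n < 2^-1 by near: n; exact: near_p_half.
have pN : -1 < - p n by rewrite ltrN2; lra.
have q0 : 0 < 1 - p n by rewrite subr_gt0; lra.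
have cE : expR (- c - eps n) = n%:R * expR (- L n).
  by rewrite [X in X * expR (- L n)]natE // mulrAC -expRD subrr expR0 mul1r.
rewrite cE -mulrA; apply/andP; split; rewrite ler_wpM2l //; last first.
  by apply: le_trans (expX_onep_le n pN) _; rewrite mulrN mulrC.
rewrite -expRD; apply: le_trans (expX_onep_ge n pN); rewrite ler_expR.
rewrite le_eqVlt; apply/orP; left; apply/eqP; field; exact: lt0r_neq0.
Unshelve. all: by end_near. Qed.

Lemma cvg_qn : (1 - p n) ^+ n @[n --> \oo] --> (0 : R).
Proof.
have h : n%:R * (1 - p n) ^+ n * n%:R^-1 @[n --> \oo] --> (0 : R).
  rewrite -[X in _ --> X](mulr0 lam); apply: cvgM; first exact: cvg_zero_rows.
  by apply/gtr0_cvgV0; [near=> n; rewrite ltr0n; near: n; exact: near_pos_nat|exact: cvgr_idn].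
apply: cvg_trans h; apply: near_eq_cvg.
near=> n; have n0 : (0 < n)%N by near: n; exact: near_pos_nat.
by rewrite mulrAC divff ?mul1r // pnatr_eq0 -lt0n.
Unshelve. all: by end_near. Qed.

Let cvg_qinv : (1 - p n)^-1 @[n --> \oo] --> (1 : R).
Proof.
rewrite -[X in _ --> X]invr1 -[X in X^-1]subr0; apply: cvgV.
  by rewrite subr0 oner_neq0.
by apply: cvgB; [exact: cvg_cst|exact: cvg_p].
Qed.

Let qpredE : \forall n \near \oo, (1 - p n) ^+ n * (1 - p n)^-1 = (1 - p n) ^+ n.-1.
Proof.
near=> n; have n0 : (0 < n)%N by near: n; exact: near_pos_nat.
have ph : p n < 2^-1 by near: n; exact: near_p_half.
have q0 : 1 - p n != 0 by rewrite gt_eqF // subr_gt0; lra.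
have -> : (1 - p n) ^+ n = (1 - p n) ^+ n.-1 * (1 - p n) by rewrite -exprSr prednK.
by rewrite mulfK.
Unshelve. all: by end_near. Qed.

Lemma cvg_qn_pred : (1 - p n) ^+ n.-1 @[n --> \oo] --> (0 : R).
Proof.
have h : (1 - p n) ^+ n * (1 - p n)^-1 @[n --> \oo] --> (0 : R).
  by rewrite -[X in _ --> X](mul0r 1); apply: cvgM; [exact: cvg_qn|].
by apply: cvg_trans h; apply: near_eq_cvg; exact: filterS qpredE.
Qed.

Lemma cvg_zero_rows_pred : n%:R * (1 - p n) ^+ n.-1 @[n --> \oo] --> lam.
Proof.
have h : n%:R * (1 - p n) ^+ n * (1 - p n)^-1 @[n --> \oo] --> lam.
  by rewrite -[X in _ --> X]mulr1; apply: cvgM; [exact: cvg_zero_rows|].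
apply: cvg_trans h; apply: near_eq_cvg; apply: filterS qpredE => n <-.
by rewrite mulrA.
Qed.

End ThresholdLimits.

(** * The limiting probability *)

Section Threshold.
Variables (R : realType) (c : R) (p eps : nat -> R).
Hypothesis p01 : forall n, 0 <= p n <= 1.
Hypothesis pE : forall n, (0 < n)%N -> p n = (ln n%:R + c + eps n) / n%:R.
Hypothesis eps0 : eps n @[n --> \oo] --> (0 : R).

Local Notation L n := (p n * n%:R).
Local Notation lam := (expR (- c)).

Let nq := cvg_zero_rows pE eps0.
Let qn := cvg_qn pE eps0.
Let nq1 := cvg_zero_rows_pred pE eps0.
Let qn1 := cvg_qn_pred pE eps0.

Lemma cvg_Pr_no_zero_row :
  Pr (p n) (fun E : digraph n => zero_rows E == finset.set0) @[n --> \oo] --> expR (- lam).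
Proof.
under eq_fun do rewrite Pr_no_zero_row //.
apply: cvg_expX_onep; first by rewrite -oppr0; exact: cvgN.
under eq_fun do rewrite mulrN.
exact: cvgN.
Qed.

Lemma cvg_Pr_no_zero_row_col :
  Pr (p n) (fun E : digraph n => (zero_rows E == finset.set0)
     && (zero_rows (transpose E) == finset.set0)) @[n --> \oo] --> expR (- lam) ^+ 2.
Proof.
pose err n := n%:R * (1 - p n) ^+ n * ((1 + (1 - p n) ^+ n.-1) ^+ n - (1 + (1 - p n) ^+ n) ^+ n).
have err0 : err n @[n --> \oo] --> (0 : R).
  rewrite -[X in _ --> X](mulr0 lam); apply: cvgM; first exact: nq.
  rewrite -[X in _ --> X](subrr (expR lam)); apply: cvgB; exact: cvg_expX_onep.
have sq : ((1 - (1 - p n) ^+ n) ^+ n) ^+ 2 @[n --> \oo] --> expR (- lam) ^+ 2.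
  under eq_fun do rewrite expr2 -Pr_no_zero_row //.
  by rewrite expr2; apply: cvgM; exact: cvg_Pr_no_zero_row.
apply: (squeeze_cvgr (f := fun n => ((1 - (1 - p n) ^+ n) ^+ n) ^+ 2 - err n)
                     (h := fun n => ((1 - (1 - p n) ^+ n) ^+ n) ^+ 2 + err n)).
- near=> n; rewrite -ler_distl; exact: Pr_no_zero_row_col_dist.
- by rewrite -[X in _ --> X]subr0; exact: cvgB.
- by rewrite -[X in _ --> X]addr0; exact: cvgD.
Unshelve. all: by end_near. Qed.

Lemma cvg_Pr_no_zero_line :
  Pr (p n) (@no_zero_line n) @[n --> \oo] --> 1 - (1 - expR (- lam)) ^+ 2.
Proof.
have -> : 1 - (1 - expR (- lam)) ^+ 2 = expR (- lam) + expR (- lam) - expR (- lam) ^+ 2.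
  by ring.
have h : Pr (p n) (fun E : digraph n => zero_rows E == finset.set0)
   + Pr (p n) (fun E : digraph n => zero_rows E == finset.set0)
   - Pr (p n) (fun E : digraph n => (zero_rows E == finset.set0)
     && (zero_rows (transpose E) == finset.set0)) @[n --> \oo]
   --> expR (- lam) + expR (- lam) - expR (- lam) ^+ 2.
  apply: cvgB; last exact: cvg_Pr_no_zero_row_col.
  by apply: cvgD; exact: cvg_Pr_no_zero_row.
apply: cvg_trans h; apply: near_eq_cvg; near=> n.
rewrite -[X in _ + X - _]Pr_transpose -Pr_predU addrK //.
Unshelve. all: by end_near. Qed.

Lemma cvg_Pr_isolated : Pr (p n) (@isolated n) @[n --> \oo] --> (0 : R).
Proof.
have h : n%:R * (1 - p n) ^+ n * (1 - p n) ^+ n.-1 @[n --> \oo] --> (0 : R).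
  by rewrite -[X in _ --> X](mulr0 lam); apply: cvgM.
apply: squeeze_cvgr (cvg_cst _) h; near=> n; rewrite Pr_ge0 //=.
by rewrite -mulrA -exprD; exact: Pr_isolated_le.
Unshelve. all: by end_near. Qed.

Lemma cvg_Pr_zero_block : Pr (p n) (@zero_block n) @[n --> \oo] --> (0 : R).
Proof.
have h : 4 * (L n ^+ 0 * expR (- (9^-1 * L n))) @[n --> \oo] --> (0 : R).
  rewrite -[X in _ --> X](mulr0 4); apply: cvgM; first exact: cvg_cst.
  by apply: (cvg_mean_decay pE eps0); rewrite invr_gt0.
have h1 : \forall n \near \oo, 4 * (L n ^+ 0 * expR (- (9^-1 * L n))) < 1.
  exact: cvgr_lt h _ ltr01.
apply: squeeze_cvgr (cvg_cst _) h; near=> n; rewrite Pr_ge0 //=.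
have n0 : (0 < n)%N by near: n; exact: near_pos_nat.
apply: le_trans (Pr_zero_block_le n (p01 n)) _.
rewrite (_ : _ / 9 = n%:R * (9^-1 * L n)); last by ring.
rewrite -mulrN expRM_natl -exprMn expr0 mul1r.
have : 4 * (L n ^+ 0 * expR (- (9^-1 * L n))) < 1 by near: n.
rewrite expr0 mul1r; set b := 4 * _ => b1.
have b0 : 0 <= b by rewrite mulr_ge0 ?expR_ge0.
by rewrite -[leRHS]expr1 ler_wiXn2l // ltW.
Unshelve. all: by end_near. Qed.

(** The geometric sum is dominated by its first term, for s = 2, which is
    n b ^ 2; as n is of order exp (L n) and b of order
    (L n) ^ 2 exp (- 2 / 3 L n), it decays like (L n) ^ 4 exp (- L n / 3). *)
Lemma cvg_Pr_deficient : Pr (p n) (@deficient n) @[n --> \oo] --> (0 : R).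
Proof.
pose b n : R := 32 * L n ^+ 2 * expR (- (2 / 3 * L n)).
have b_to0 : b n @[n --> \oo] --> (0 : R).
  rewrite -[X in _ --> X](mulr0 32).
  under eq_fun do rewrite /b -mulrA.
  by apply: cvgM; [exact: cvg_cst|apply: (cvg_mean_decay pE eps0); lra].
have h : 2048 * expR (- c - eps n) * (L n ^+ 4 * expR (- (3^-1 * L n))) @[n --> \oo] --> (0 : R).
  rewrite -[X in _ --> X](mulr0 (2048 * lam)); apply: cvgM.
    by apply: cvgM; [exact: cvg_cst|exact: cvg_expR_shift eps0].
  by apply: (cvg_mean_decay pE eps0); rewrite invr_gt0.
have L1 : \forall n \near \oo, 1 <= L n.
  by have /cvgryPge := cvg_mean pE eps0; exact.
have b2 : \forall n \near \oo, b n < 2^-1 by apply: cvgr_lt b_to0 _ _; rewrite invr_gt0.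
apply: squeeze_cvgr (cvg_cst _) h; near=> n; rewrite Pr_ge0 //=.
have n0 : (0 < n)%N by near: n; exact: near_pos_nat.
have L1n : 1 <= L n by near: n.
apply: le_trans (Pr_deficient_le (p01 n) L1n) _.
rewrite -mulr_sumr -/(b n).
have b0 : 0 <= b n by rewrite /b !mulr_ge0 ?expR_ge0 ?exprn_ge0 //; case/andP: (p01 n).
have bh : 0 <= b n <= 2^-1 by rewrite b0 /= ltW //; near: n.
apply: le_trans (ler_wpM2l (ler0n R n) (sum_geometric_tail n.+1 bh)) _.
rewrite [X in X * _ <= _](natE pE n0).
rewrite /b; have -> : expR (- (2 / 3 * L n)) = expR (- (3^-1 * L n)) ^+ 2.
  by rewrite -expRM_natl; congr expR; field.
have -> : expR (L n) = (expR (- (3^-1 * L n)) ^+ 3)^-1.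
  by rewrite -expRM_natl -expRN; congr expR; field.
have := expR_gt0 (- (3^-1 * L n)); move: (expR (- (3^-1 * _))) => e e0.
rewrite le_eqVlt; apply/orP; left; apply/eqP; field; exact: lt0r_neq0.
Unshelve. all: by end_near. Qed.

Lemma cvg_Pr_exceptional : Pr (p n) (@exceptional n) @[n --> \oo] --> (0 : R).
Proof.
have h : Pr (p n) (@deficient n) + (Pr (p n) (@deficient n)
    + (Pr (p n) (@zero_block n) + Pr (p n) (@isolated n))) @[n --> \oo] --> (0 : R).
  rewrite -[X in _ --> X](addr0 0) -[X in _ --> _ + X](addr0 0) -[X in _ --> _ + (_ + X)](addr0 0).
  apply: cvgD; first exact: cvg_Pr_deficient.
  apply: cvgD; first exact: cvg_Pr_deficient.
  by apply: cvgD; [exact: cvg_Pr_zero_block|exact: cvg_Pr_isolated].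
apply: squeeze_cvgr (cvg_cst _) h; near=> n; rewrite Pr_ge0 //=.
rewrite -[X in _ <= _ + (X + _)]Pr_transpose //.
do 3 (apply: le_trans (Pr_or_le (p01 n) _ _) _; rewrite lerD2l //).
Unshelve. all: by end_near. Qed.

(** The numbers of zero rows and of zero columns behave like independent Poisson
    variables of mean lam; the limit is the probability that one of them is 0. *)
Lemma cvg_gnp_prob_diagonalizable :
  gnp_prob (p n) (@structurally_diagonalizable R n) @[n --> \oo]
    --> 1 - (1 - expR (- lam)) ^+ 2.
Proof.
apply: (squeeze_cvgr (f := fun n => Pr (p n) (@no_zero_line n) - Pr (p n) (@exceptional n))
                     (h := fun n => Pr (p n) (@no_zero_line n) + Pr (p n) (@exceptional n))).
- near=> n; rewrite -ler_distl; apply: gnp_prob_dist => //.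
  by near: n; exact: near_pos_nat.
- rewrite -[X in _ --> X]subr0; apply: cvgB; [exact: cvg_Pr_no_zero_line|exact: cvg_Pr_exceptional].
- rewrite -[X in _ --> X]addr0; apply: cvgD; [exact: cvg_Pr_no_zero_line|exact: cvg_Pr_exceptional].
Unshelve. all: by end_near. Qed.

End Threshold.

Theorem theorem4p3 (R : realType) (c : R) (p eps : nat -> R)
  (p01 : forall n, 0 <= p n <= 1)
  (pE : forall n, (0 < n)%N -> p n = (ln n%:R + c + eps n) / n%:R)
  (eps0 : eps n @[n --> \oo] --> (0 : R)) :
  let P n := gnp_prob (p n) (@structurally_diagonalizable R n) in
  cvg (P n @[n --> \oo]) /\
  lim (P n @[n --> \oo]) <= 1 - expR (- 2 * expR (- c)) * expR (- 2 * c).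
Proof.
move=> P; have Pcvg := cvg_gnp_prob_diagonalizable p01 pE eps0.
split; first by apply/cvg_ex; eexists; exact: Pcvg.
rewrite (cvg_lim _ Pcvg) // lerD2l lerN2; set l := expR (- c).
have -> : expR (- 2 * l) * expR (- 2 * c) = (expR (- l) * l) ^+ 2.
  by rewrite exprMn -!expRM_natl; congr (expR _ * expR _); ring.
have e0 := expR_gt0 (- l); have l0 : 0 < l := expR_gt0 _.
have le1 : expR (- l) * l <= 1 - expR (- l).
  have := expR_ge1Dx l; rewrite -(ler_pM2l e0) -expRD addNr expR0; lra.
by rewrite lerXn2r // nnegrE ?(le_trans _ le1) // mulr_ge0 // ltW.
Qed.
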